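(* Let $\mathbb X$ be a complex Banach space, let $\mathcal F$ be a closed nontrivial subspace of $BC(\mathbb R,\mathbb X)$ that satisfies Condition F, and let $\Lambda$ be a closed subset of $\mathbb R$. Then $\sigma(\tilde{\mathcal D}_\Lambda)\subset i\Lambda$.
   Context: $BC(\mathbb R,\mathbb X)$ is the Banach space of bounded continuous functions $\mathbb R\to\mathbb X$ with the sup-norm. The operator $\mathcal D$ on $BC(\mathbb R,\mathbb X)$ has domain $D(\mathcal D)=\{f\in BC(\mathbb R,\mathbb X): f \text{ differentiable}, f'\in BC(\mathbb R,\mathbb X)\}$ and $\mathcal Df=f'$. For $\mathrm{Re}\,\lambda\neq0$, $R(\lambda,\mathcal D)=(\lambda-\mathcal D)^{-1}$ exists: $R(\lambda,\mathcal D)f(\xi)=\int_0^\infty e^{-\lambda\eta}f(\xi+\eta)\,d\eta$ if $\mathrm{Re}\,\lambda>0$, and $=-\int_{-\infty}^0 e^{-\lambda\eta}f(\xi+\eta)\,d\eta$ if $\mathrm{Re}\,\lambda<0$. Condition F: a closed subspace $\mathcal F\subset BC(\mathbb R,\mathbb X)$ satisfies Condition F if either $\mathcal F=\{0\}$ or: (1) $\mathcal F$ contains all constant functions; (2) if $f\in\mathcal F$ and $\xi\in\mathbb R$ then $t\mapsto e^{i\xi t}f(t)$ is in $\mathcal F$; (3) $R(\lambda,\mathcal D)\mathcal F\subset\mathcal F$ for all $\lambda\in\mathbb C$ with $\mathrm{Re}\,\lambda\ne0$; (4) if $f\in\mathcal F$ and $F$ is a bounded primitive of $f$, then $F\in\mathcal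 F$; (5) if $B\in L(\mathbb X)$ (bounded linear operator on $\mathbb X$) and $f\in\mathcal F$ then $Bf(\cdot)\in\mathcal F$. Let $\mathbb Y=BC(\mathbb R,\mathbb X)/\mathcal F$, with $\tilde f$ the class of $f$. $D(\tilde{\mathcal D})$ is the set of classes that contain an element of $D(\mathcal D)$, and $\tilde{\mathcal D}\tilde f=\widetilde{f'}$ whenever the class $\tilde f$ contains $f\in D(\mathcal D)$. For $\mathrm{Re}\,\lambda\ne0$, $R(\lambda,\tilde{\mathcal D})\tilde f$ is the class of $R(\lambda,\mathcal D)f$. The reduced spectrum $sp_{\mathcal F}(f)=sp_{\mathcal F}(\tilde f)$ of $f\in BC(\mathbb R,\mathbb X)$ is the set of $\xi\in\mathbb R$ such that the $\mathbb Y$-valued function $\lambda\mapsto R(\lambda,\tilde{\mathcal D})\tilde f$ on $\mathbb C\setminus i\mathbb R$ has no analytic extension to any neighborhood of $i\xi$ in $\mathbb C$. $\Lambda_{\mathcal F}(\mathbb X)=\{\tilde f\in\mathbb Y: sp_{\mathcal F}(\tilde f)\subset\Lambda\}$, a closed subspace of $\mathbb Y$. $\tilde{\mathcal D}_\Lambda$ is the part of $\tilde{\mathcal D}$ in $\Lambda_{\mathcal F}(\mathbb X)$: $D(\tilde{\mathcal D}_\Lambda)=\{\tilde f\in D(\tilde{\mathcal D})\cap\Lambda_{\mathcal F}(\mathbb X):\tilde{\mathcal D}\tilde f\in\Lambda_{\mathcal F}(\mathbb X)\}$ and $\tilde{\mathcal D}_\Lambda\tilde f=\tilde{\mathcal D}\tilde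 f$. *)

(* Defs.v *)
(* Built on Coquelicot's hierarchy: a complex normed (resp. Banach) space is a
   [NormedModule C_AbsRing] (resp. [CompleteNormedModule C_AbsRing]). *)
From Stdlib Require Import Reals Lra.
From Stdlib Require Import ClassicalEpsilon FunctionalExtensionality
  PropExtensionality ProofIrrelevance.
From Coquelicot Require Import Coquelicot.

Open Scope R_scope.

Notation CNormedModule := (NormedModule C_AbsRing).

Lemma abs_C (z : C) : @abs C_AbsRing z = Cmod z.
Proof. reflexivity. Qed.

Lemma Cmod_RtoC (x : R) : Cmod (RtoC x) = Rabs x.
Proof. apply Cmod_R. Qed.

(* Restriction of scalars from C to R: derivatives of functions R -> X are
   taken in the real normed space underlying X. *)
Section Realify.
Context (V : CNormedModule).

Definition real_scal (r : R) (x : V) : V := @scal C_AbsRing V (RtoC r) x.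

Lemma real_scal_assoc (x y : R) (u : V) :
  real_scal x (real_scal y u) = real_scal (x * y) u.
Proof.
unfold real_scal; rewrite scal_assoc; f_equal.
rewrite RtoC_mult; reflexivity.
Qed.

Lemma real_scal_one (u : V) : real_scal 1 u = u.
Proof. exact (@scal_one C_AbsRing V u). Qed.

Lemma real_scal_distr_l (x : R) (u v : V) :
  real_scal x (plus u v) = plus (real_scal x u) (real_scal x v).
Proof. exact (@scal_distr_l C_AbsRing V (RtoC x) u v). Qed.

Lemma real_scal_distr_r (x y : R) (u : V) :
  real_scal (x + y) u = plus (real_scal x u) (real_scal y u).
Proof.
unfold real_scal; rewrite RtoC_plus.
exact (@scal_distr_r C_AbsRing V (RtoC x) (RtoC y) u).
Qed.

Definition real_ModuleSpace_mixin :=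
  ModuleSpace.Mixin R_Ring V real_scal real_scal_assoc real_scal_one
    real_scal_distr_l real_scal_distr_r.

Definition real_ModuleSpace_class : ModuleSpace.class_of R_Ring V :=
  ModuleSpace.Class R_Ring V (AbelianGroup.class V) real_ModuleSpace_mixin.

Definition real_NormedModuleAux : NormedModuleAux R_AbsRing :=
  NormedModuleAux.Pack R_AbsRing V
    (NormedModuleAux.Class R_AbsRing V real_ModuleSpace_class
       (UniformSpace.class V)) V.

Lemma real_norm_scal (l : R) (x : V) :
  @norm C_AbsRing V (real_scal l x) <= Rabs l * @norm C_AbsRing V x.
Proof. rewrite <- Cmod_RtoC; exact (@norm_scal C_AbsRing V (RtoC l) x). Qed.

Definition real_NormedModule_mixin :
    NormedModule.mixin_of R_AbsRing real_NormedModuleAux :=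
  NormedModule.Mixin R_AbsRing real_NormedModuleAux
    (@norm C_AbsRing V) (@norm_factor C_AbsRing V)
    (@norm_triangle C_AbsRing V) real_norm_scal
    (@norm_compat1 C_AbsRing V) (@norm_compat2 C_AbsRing V)
    (@norm_eq_zero C_AbsRing V).

Definition realify : NormedModule R_AbsRing :=
  NormedModule.Pack R_AbsRing V
    (NormedModule.Class R_AbsRing V
       (NormedModuleAux.class R_AbsRing real_NormedModuleAux)
       real_NormedModule_mixin) V.

End Realify.

(* A complex normed space from a module and a norm, with the norm balls. *)
Section NormedOf.
Context (V : ModuleSpace C_Ring) (N : V -> R).
Hypothesis N_triangle : forall x y : V, N (plus x y) <= N x + N y.
Hypothesis N_scal : forall (l : C) (x : V), N (scal l x) <= Cmod l * N x.
Hypothesis N_eq_zero : forall x : V, N x = 0 -> x = zero.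

Definition normed_ball (x : V) (e : R) (y : V) : Prop := N (minus y x) < e.

Lemma N_zero : N zero <= 0.
Proof.
assert (H := N_scal (RtoC 0) zero).
rewrite Cmod_RtoC, Rabs_R0, Rmult_0_l in H.
rewrite (scal_zero_r (RtoC 0)) in H; exact H.
Qed.

Lemma N_opp (x : V) : N (opp x) <= N x.
Proof.
assert (H := N_scal (RtoC (-1)) x).
rewrite Cmod_RtoC, Rabs_m1, Rmult_1_l in H.
replace (opp x) with (scal (RtoC (-1)) x); [exact H|].
rewrite <- (scal_opp_one x); f_equal.
unfold opp, one; simpl; unfold RtoC, Copp; simpl; f_equal; lra.
Qed.

Lemma normed_ball_refl (x : V) (e : posreal) : normed_ball x e x.
Proof.
unfold normed_ball; rewrite minus_eq_zero.
apply Rle_lt_trans with (1 := N_zero); apply cond_pos.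
Qed.

Lemma normed_ball_sym (x y : V) (e : R) :
  normed_ball x e y -> normed_ball y e x.
Proof.
unfold normed_ball; intros H; apply Rle_lt_trans with (2 := H).
rewrite <- (opp_minus y x); apply N_opp.
Qed.

Lemma normed_ball_trans (x y z : V) (e1 e2 : R) :
  normed_ball x e1 y -> normed_ball y e2 z -> normed_ball x (e1 + e2) z.
Proof.
unfold normed_ball; intros H1 H2.
rewrite (minus_trans y).
apply Rle_lt_trans with (1 := N_triangle _ _); lra.
Qed.

Definition normed_UniformSpace_mixin : UniformSpace.mixin_of V :=
  UniformSpace.Mixin V zero normed_ball
    normed_ball_refl normed_ball_sym normed_ball_trans.

Definition normed_NormedModuleAux : NormedModuleAux C_AbsRing :=
  NormedModuleAux.Pack C_AbsRing V
    (NormedModuleAux.Class C_AbsRing V (ModuleSpace.class C_Ring V)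
       normed_UniformSpace_mixin) V.

Lemma normed_compat2 (x y : V) (e : posreal) :
  normed_ball x e y -> N (minus y x) < 1 * e.
Proof. rewrite Rmult_1_l; trivial. Qed.

Definition normed_of : CNormedModule :=
  NormedModule.Pack C_AbsRing V
    (NormedModule.Class C_AbsRing V
       (NormedModuleAux.class C_AbsRing normed_NormedModuleAux)
       (NormedModule.Mixin C_AbsRing normed_NormedModuleAux N 1
          N_triangle N_scal (fun x y e H => H) normed_compat2 N_eq_zero)) V.

End NormedOf.

Section BoundedContinuous.
Context (X : CNormedModule).

Record bcfun := BCFun {
  bc_fun :> R -> X;
  bc_cont : forall t : R, continuous bc_fun t;
  bc_bdd : exists M : R, forall t : R, norm (bc_fun t) <= M }.

Lemma bcfun_ext (f g : bcfun) : (forall t, f t = g t) -> f = g.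
Proof.
destruct f as [f cf bf], g as [g cg bg]; simpl; intros H.
assert (E : f = g) by (apply functional_extensionality; exact H).
subst g; f_equal; apply proof_irrelevance.
Qed.

Program Definition bc_plus (f g : bcfun) : bcfun :=
  BCFun (fun t => plus (f t) (g t)) _ _.
Next Obligation. exact (continuous_plus f g t (bc_cont f t) (bc_cont g t)). Qed.
Next Obligation.
destruct (bc_bdd f) as [M HM], (bc_bdd g) as [N HN]; exists (M + N); intros t.
apply Rle_trans with (1 := norm_triangle _ _); apply Rplus_le_compat; auto.
Qed.

Program Definition bc_zero : bcfun := BCFun (fun _ => zero) _ _.
Next Obligation. apply continuous_const. Qed.
Next Obligation.
exists 0; intros _; rewrite norm_zero; apply Rle_refl.
Qed.

Program Definition bc_scal (l : C) (f : bcfun) : bcfun :=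
  BCFun (fun t => scal (l : C_AbsRing) (f t)) _ _.
Next Obligation. exact (continuous_scal_r (l : C_AbsRing) f t (bc_cont f t)). Qed.
Next Obligation.
destruct (bc_bdd f) as [M HM]; exists (Cmod l * M); intros t.
apply Rle_trans with (1 := norm_scal _ _).
apply Rmult_le_compat_l; [apply Cmod_ge_0 | apply HM].
Qed.

Program Definition bc_opp (f : bcfun) : bcfun := BCFun (fun t => opp (f t)) _ _.
Next Obligation. exact (continuous_opp f t (bc_cont f t)). Qed.
Next Obligation.
destruct (bc_bdd f) as [M HM]; exists M; intros t; rewrite norm_opp; apply HM.
Qed.

Definition bc_AbelianMonoid : AbelianMonoid.
Proof.
refine (AbelianMonoid.Pack bcfun
  (AbelianMonoid.Mixin bcfun bc_plus bc_zero _ _ _) bcfun).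
- intros f g; apply bcfun_ext; intros t; apply plus_comm.
- intros f g h; apply bcfun_ext; intros t; apply plus_assoc.
- intros f; apply bcfun_ext; intros t; apply plus_zero_r.
Defined.

Definition bc_AbelianGroup : AbelianGroup.
Proof.
refine (AbelianGroup.Pack bcfun
  (AbelianGroup.Class bcfun (AbelianMonoid.class bc_AbelianMonoid)
    (AbelianGroup.Mixin bc_AbelianMonoid bc_opp _)) bcfun).
intros f; apply bcfun_ext; intros t; apply (plus_opp_r (f t)).
Defined.

Definition bc_ModuleSpace : ModuleSpace C_Ring.
Proof.
refine (ModuleSpace.Pack C_Ring bcfun
  (ModuleSpace.Class C_Ring bcfun (AbelianGroup.class bc_AbelianGroup)
    (ModuleSpace.Mixin C_Ring bc_AbelianGroup bc_scal _ _ _ _)) bcfun).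
- intros x y u; apply bcfun_ext; intros t; apply (@scal_assoc C_AbsRing).
- intros u; apply bcfun_ext; intros t; apply (@scal_one C_AbsRing).
- intros x u v; apply bcfun_ext; intros t; apply (@scal_distr_l C_AbsRing).
- intros x y u; apply bcfun_ext; intros t; apply (@scal_distr_r C_AbsRing).
Defined.

Definition sup_norm (f : bcfun) : R :=
  real (Lub_Rbar (fun r => exists t : R, r = norm (f t))).

Lemma sup_norm_lub (f : bcfun) :
  is_lub_Rbar (fun r => exists t : R, r = norm (f t)) (sup_norm f).
Proof.
unfold sup_norm.
assert (H := Lub_Rbar_correct (fun r => exists t : R, r = norm (f t))).
destruct (Lub_Rbar _) as [l| |]; simpl.
- exact H.
- destruct (bc_bdd f) as [M HM]; exfalso.
  apply (proj2 H M); intros r [t ->]; apply HM.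
- exfalso; apply (proj1 H (norm (f 0))); exists 0; reflexivity.
Qed.

Lemma norm_le_sup (f : bcfun) (t : R) : norm (f t) <= sup_norm f.
Proof. apply (proj1 (sup_norm_lub f)); exists t; reflexivity. Qed.

Lemma sup_norm_le (f : bcfun) (M : R) :
  (forall t, norm (f t) <= M) -> sup_norm f <= M.
Proof. intros H; apply (proj2 (sup_norm_lub f) M); intros r [t ->]; apply H. Qed.

Lemma sup_norm_triangle (f g : bcfun) :
  sup_norm (bc_plus f g) <= sup_norm f + sup_norm g.
Proof.
apply sup_norm_le; intros t; apply Rle_trans with (1 := norm_triangle _ _).
apply Rplus_le_compat; apply norm_le_sup.
Qed.

Lemma sup_norm_scal (l : C) (f : bcfun) :
  sup_norm (bc_scal l f) <= Cmod l * sup_norm f.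
Proof.
apply sup_norm_le; intros t; apply Rle_trans with (1 := norm_scal _ _).
apply Rmult_le_compat_l; [apply Cmod_ge_0 | apply norm_le_sup].
Qed.

Lemma sup_norm_eq_zero (f : bcfun) : sup_norm f = 0 -> f = bc_zero.
Proof.
intros H; apply bcfun_ext; intros t; simpl.
apply (@norm_eq_zero C_AbsRing); apply Rle_antisym; [|apply norm_ge_0].
rewrite <- H; apply norm_le_sup.
Qed.

Definition BC : CNormedModule :=
  normed_of bc_ModuleSpace sup_norm
    sup_norm_triangle sup_norm_scal sup_norm_eq_zero.

End BoundedContinuous.

Arguments bc_fun {X} _ _.

Record closed_subspace (V : CNormedModule) := ClosedSubspace {
  cs_mem :> V -> Prop;
  cs_zero : cs_mem zero;
  cs_plus : forall x y : V, cs_mem x -> cs_mem y -> cs_mem (plus x y);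
  cs_scal : forall (l : C) (x : V),
    cs_mem x -> cs_mem (scal (l : C_AbsRing) x);
  cs_closed : closed cs_mem }.

Lemma minus_plus_plus (G : AbelianGroup) (x y z t : G) :
  minus (plus x y) (plus z t) = plus (minus x z) (minus y t).
Proof.
unfold minus; rewrite opp_plus, <- !plus_assoc; f_equal.
rewrite !plus_assoc; f_equal; apply plus_comm.
Qed.

Lemma opp_minus_distr (G : AbelianGroup) (x y : G) :
  opp (minus x y) = minus (opp x) (opp y).
Proof. unfold minus; apply opp_plus. Qed.

Lemma minus_minus_zero (G : AbelianGroup) (x y : G) :
  minus (minus x y) (minus zero y) = x.
Proof.
assert (E : minus zero y = opp y) by apply plus_zero_l.
rewrite E; unfold minus.
rewrite <- plus_assoc; transitivity (plus x zero); [|apply plus_zero_r].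
f_equal; exact (plus_opp_r (opp y)).
Qed.

Section Quotient.
Context (V : CNormedModule) (S : closed_subspace V).

Record coset := Coset {
  coset_mem : V -> Prop;
  coset_ex : exists f : V, coset_mem = (fun g => S (minus g f)) }.

Definition coset_of (f : V) : coset :=
  Coset (fun g => S (minus g f)) (ex_intro _ f eq_refl).

Definition repr (a : coset) : V :=
  proj1_sig (constructive_indefinite_description _ (coset_ex a)).

Lemma S_opp (x : V) : S x -> S (opp x).
Proof.
intros H.
assert (E : scal (opp (@one C_AbsRing)) x = opp x) by exact (@scal_opp_one C_AbsRing V x).
rewrite <- E; exact (cs_scal V S _ x H).
Qed.

Lemma coset_eq (a b : coset) : coset_mem a = coset_mem b -> a = b.
Proof.
destruct a as [a Ha], b as [b Hb]; simpl; intros H; subst b.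
f_equal; apply proof_irrelevance.
Qed.

Lemma coset_ofK (a : coset) : coset_of (repr a) = a.
Proof.
unfold repr; destruct (constructive_indefinite_description _ _) as [f Hf].
apply coset_eq; simpl; symmetry; exact Hf.
Qed.

Lemma coset_of_eq (f g : V) : S (minus f g) -> coset_of f = coset_of g.
Proof.
intros H; apply coset_eq; simpl; apply functional_extensionality; intros h.
apply propositional_extensionality; split; intros K.
- rewrite (minus_trans f); apply (cs_plus V S); assumption.
- rewrite (minus_trans g); apply (cs_plus V S); [assumption|].
  rewrite <- (opp_minus f g); apply S_opp; assumption.
Qed.

Lemma mem_coset_of (f : V) : coset_mem (coset_of f) f.
Proof. simpl; rewrite minus_eq_zero; apply cs_zero. Qed.

Lemma coset_of_inj (f g : V) : coset_of f = coset_of g -> S (minus f g).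
Proof.
intros H; change (coset_mem (coset_of g) f); rewrite <- H; apply mem_coset_of.
Qed.

Lemma coset_memE (a : coset) (f : V) : coset_mem a f -> coset_of f = a.
Proof.
intros H; rewrite <- (coset_ofK a) in H |- *; apply coset_of_eq; exact H.
Qed.

Definition q_plus (a b : coset) : coset := coset_of (plus (repr a) (repr b)).
Definition q_zero : coset := coset_of zero.
Definition q_opp (a : coset) : coset := coset_of (opp (repr a)).
Definition q_scal (l : C) (a : coset) : coset :=
  coset_of (scal (l : C_AbsRing) (repr a)).

Lemma repr_coset_of (f : V) : S (minus (repr (coset_of f)) f).
Proof. apply coset_of_inj, coset_ofK. Qed.

Lemma q_plusE (f g : V) :
  q_plus (coset_of f) (coset_of g) = coset_of (plus f g).
Proof.
apply coset_of_eq.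
rewrite (minus_plus_plus (NormedModule.AbelianGroup C_AbsRing V)).
apply (cs_plus V S); apply repr_coset_of.
Qed.

Lemma q_scalE (l : C) (f : V) :
  q_scal l (coset_of f) = coset_of (scal (l : C_AbsRing) f).
Proof.
apply coset_of_eq.
rewrite <- (@scal_minus_distr_l C_AbsRing V l).
apply (cs_scal V S), repr_coset_of.
Qed.

Lemma q_oppE (f : V) : q_opp (coset_of f) = coset_of (opp f).
Proof.
apply coset_of_eq.
rewrite <- (opp_minus_distr (NormedModule.AbelianGroup C_AbsRing V)).
apply S_opp, repr_coset_of.
Qed.

Definition q_AbelianMonoid : AbelianMonoid.
Proof.
refine (AbelianMonoid.Pack coset
  (AbelianMonoid.Mixin coset q_plus q_zero _ _ _) coset).
- intros a b; unfold q_plus; f_equal; apply plus_comm.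
- intros a b c; rewrite <- (coset_ofK a), <- (coset_ofK b), <- (coset_ofK c).
  rewrite !q_plusE; f_equal; apply plus_assoc.
- intros a; rewrite <- (coset_ofK a); unfold q_zero.
  rewrite q_plusE; f_equal; apply plus_zero_r.
Defined.

Definition q_AbelianGroup : AbelianGroup.
Proof.
refine (AbelianGroup.Pack coset
  (AbelianGroup.Class coset (AbelianMonoid.class q_AbelianMonoid)
    (AbelianGroup.Mixin q_AbelianMonoid q_opp _)) coset).
intros a; rewrite <- (coset_ofK a), q_oppE.
change (q_plus (coset_of (repr a)) (coset_of (opp (repr a))) = q_zero).
rewrite q_plusE; unfold q_zero; f_equal; apply (plus_opp_r (repr a)).
Defined.

Definition q_ModuleSpace : ModuleSpace C_Ring.
Proof.
refine (ModuleSpace.Pack C_Ring coset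
  (ModuleSpace.Class C_Ring coset (AbelianGroup.class q_AbelianGroup)
    (ModuleSpace.Mixin C_Ring q_AbelianGroup q_scal _ _ _ _)) coset).
- intros x y a; rewrite <- (coset_ofK a), !q_scalE; f_equal.
  apply (@scal_assoc C_AbsRing).
- intros a; rewrite <- (coset_ofK a) at 2; unfold q_scal; f_equal.
  apply (@scal_one C_AbsRing).
- intros x a b; rewrite <- (coset_ofK a), <- (coset_ofK b).
  change (q_scal x (q_plus (coset_of (repr a)) (coset_of (repr b))) =
    q_plus (q_scal x (coset_of (repr a))) (q_scal x (coset_of (repr b)))).
  rewrite !q_scalE, !q_plusE, q_scalE; f_equal.
  apply (@scal_distr_l C_AbsRing).
- intros x y a; rewrite <- (coset_ofK a).
  change (q_scal (plus x y) (coset_of (repr a)) =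
    q_plus (q_scal x (coset_of (repr a))) (q_scal y (coset_of (repr a)))).
  rewrite !q_scalE, !q_plusE; f_equal.
  apply (@scal_distr_r C_AbsRing).
Defined.

Definition q_norm (a : coset) : R :=
  real (Glb_Rbar (fun r => exists f : V, coset_mem a f /\ r = norm f)).

Lemma q_norm_glb (a : coset) :
  is_glb_Rbar (fun r => exists f : V, coset_mem a f /\ r = norm f) (q_norm a).
Proof.
unfold q_norm.
assert (H := Glb_Rbar_correct
  (fun r => exists f : V, coset_mem a f /\ r = norm f)).
destruct (Glb_Rbar _) as [l| |]; simpl.
- exact H.
- exfalso; apply (proj1 H (norm (repr a))); exists (repr a); split; trivial.
  rewrite <- (coset_ofK a) at 1; apply mem_coset_of.
- exfalso; apply (proj2 H 0); intros r [f [_ ->]]; apply norm_ge_0.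
Qed.

Lemma q_norm_le (f : V) : q_norm (coset_of f) <= norm f.
Proof.
apply (proj1 (q_norm_glb (coset_of f))); exists f; split; trivial.
apply mem_coset_of.
Qed.

Lemma q_norm_ge (a : coset) (m : R) :
  (forall f, coset_of f = a -> m <= norm f) -> m <= q_norm a.
Proof.
intros H; apply (proj2 (q_norm_glb a) m); intros r [f [Hf ->]].
apply H, coset_memE, Hf.
Qed.

Lemma q_norm_approx (a : coset) (e : R) : 0 < e ->
  exists f, coset_of f = a /\ norm f < q_norm a + e.
Proof.
intros He; apply NNPP; intros H.
assert (K : q_norm a + e <= q_norm a); [|lra].
apply q_norm_ge; intros f Hf; apply Rnot_lt_le; intros L.
apply H; exists f; split; assumption.
Qed.

Lemma q_norm_triangle (a b : coset) :
  q_norm (q_plus a b) <= q_norm a + q_norm b.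
Proof.
apply le_epsilon; intros e He.
destruct (q_norm_approx a (e / 2)) as [f [<- Hf]]; [lra|].
destruct (q_norm_approx b (e / 2)) as [g [<- Hg]]; [lra|].
rewrite q_plusE; apply Rle_trans with (1 := q_norm_le _).
apply Rle_trans with (1 := norm_triangle _ _); lra.
Qed.

Lemma q_norm_scal (l : C) (a : coset) :
  q_norm (q_scal l a) <= Cmod l * q_norm a.
Proof.
apply le_epsilon; intros e He.
assert (Hl := Cmod_ge_0 l).
destruct (q_norm_approx a (e / (Cmod l + 1))) as [f [<- Hf]].
- apply Rdiv_lt_0_compat; lra.
- rewrite q_scalE; apply Rle_trans with (1 := q_norm_le _).
  apply Rle_trans with (1 := @norm_scal C_AbsRing V l f); rewrite abs_C.
  apply Rle_trans with (Cmod l * (q_norm (coset_of f) + e / (Cmod l + 1))).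
  + apply Rmult_le_compat_l; lra.
  + rewrite Rmult_plus_distr_l; apply Rplus_le_compat_l.
    replace e with ((Cmod l + 1) * (e / (Cmod l + 1))) at 2 by (field; lra).
    apply Rmult_le_compat_r; [|lra].
    apply Rlt_le, Rdiv_lt_0_compat; lra.
Qed.

Lemma q_norm_eq_zero (a : coset) : q_norm a = 0 -> a = q_zero.
Proof.
intros H; rewrite <- (coset_ofK a); set (g := repr a); symmetry.
apply coset_of_eq; apply (cs_closed V S); intros [d Hd].
destruct (q_norm_approx a d (cond_pos d)) as [f [Hf Hn]].
rewrite H, Rplus_0_l in Hn.
apply (Hd (minus f g)).
- apply (@norm_compat1 C_AbsRing V).
  rewrite (minus_minus_zero (NormedModule.AbelianGroup C_AbsRing V)).
  exact Hn.
- apply coset_of_inj; rewrite Hf; symmetry; apply coset_ofK.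
Qed.

Definition quotient : CNormedModule :=
  normed_of q_ModuleSpace q_norm q_norm_triangle q_norm_scal q_norm_eq_zero.

Definition cls (f : V) : quotient := coset_of f.

End Quotient.

Arguments cls {V} S f.

(* An unbounded operator is given by its graph: [A x y] means
   "x is in D(A) and A x = y". *)
Definition operator (E : CNormedModule) := E -> E -> Prop.

(* [(lambda - A)^{-1} y], when it exists and is unique.  For A = d/dt on
   BC(R, X) and Re lambda <> 0 it always is: the solution of
   lambda u - u' = y is the one-sided Laplace integral of y's translates, and
   no nonzero solution of u' = lambda u is bounded on R. *)
Definition resolvent {E : CNormedModule} (A : operator E) (lambda : C) (y : E)
    : E :=
  epsilon (inhabits zero)
    (fun x => exists z, A x z /\
       minus (scal (lambda : C_AbsRing) x) z = y).

Definition part {E : CNormedModule} (A : operator E) (P : E -> Prop)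
    : operator E :=
  fun x y => P x /\ P y /\ A x y.

(* [A] is an operator in the normed space carried by the subspace [P] of [E],
   and lambda - A has a bounded inverse defined on the whole of [P]. *)
Definition resolvent_set {E : CNormedModule} (P : E -> Prop) (A : operator E)
    (lambda : C) : Prop :=
  exists T : E -> E,
    (forall y, P y -> P (T y)) /\
    (forall x y, P x -> P y -> T (plus x y) = plus (T x) (T y)) /\
    (forall (c : C) (x : E), P x ->
       T (scal (c : C_AbsRing) x) = scal (c : C_AbsRing) (T x)) /\
    (exists M : R, forall y, P y -> norm (T y) <= M * norm y) /\
    (forall x y, A x y -> T (minus (scal (lambda : C_AbsRing) x) y) = x) /\
    (forall y, P y -> exists z, A (T y) z /\
       minus (scal (lambda : C_AbsRing) (T y)) z = y).

Definition spectrum {E : CNormedModule} (P : E -> Prop) (A : operator E)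
    (lambda : C) : Prop :=
  ~ resolvent_set P A lambda.

Definition analytic_on {E : CNormedModule} (U : C -> Prop) (G : C -> E)
    : Prop :=
  forall z : C, U z -> exists (a : nat -> E) (r : posreal),
    forall w : C, Cmod (w - z) < r ->
      is_pseries (K := C_AbsRing) a (w - z)%C (G w).

Section ReducedSpectrum.
Context (X : CNormedModule).

Definition has_derivative (f g : R -> X) : Prop :=
  forall t : R, is_derive (K := R_AbsRing) (V := realify X) f t (g t).

Definition D_op : operator (BC X) :=
  fun f g => has_derivative (bc_fun f) (bc_fun g).

Definition contains (F : closed_subspace (BC X)) (h : R -> X) : Prop :=
  exists g : BC X, F g /\ forall t : R, bc_fun g t = h t.

Definition nontrivial (F : closed_subspace (BC X)) : Prop :=
  exists f : BC X, F f /\ f <> zero.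

Definition conditionF (F : closed_subspace (BC X)) : Prop :=
  (forall f : BC X, F f <-> f = zero) \/
  ((forall x : X, contains F (fun _ => x)) /\
   (forall (f : BC X) (xi : R), F f ->
      contains F (fun t =>
        scal ((cos (xi * t), sin (xi * t)) : C_AbsRing) (bc_fun f t))) /\
   (forall (lambda : C) (f : BC X), Re lambda <> 0 -> F f ->
      F (resolvent D_op lambda f)) /\
   (forall (f : BC X) (h : R -> X), F f ->
      (exists M : R, forall t : R, norm (h t) <= M) ->
      has_derivative h (bc_fun f) -> contains F h) /\
   (forall (B : X -> X) (f : BC X), is_linear (K := C_AbsRing) B -> F f ->
      contains F (fun t => B (bc_fun f t)))).

Definition Y_space (F : closed_subspace (BC X)) : CNormedModule :=
  quotient (BC X) F.

(* The graph form matters: a function in [F] can have a derivative in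
   [BC X] that is not in [F] (e.g. F = uniformly continuous functions), so this
   relation need not be single-valued. *)
Definition Dtilde (F : closed_subspace (BC X)) : operator (Y_space F) :=
  fun a b => exists f g : BC X, D_op f g /\ a = cls F f /\ b = cls F g.

Definition Rtilde (F : closed_subspace (BC X)) (lambda : C) (f : BC X)
    : Y_space F :=
  cls F (resolvent D_op lambda f).

Definition reduced_spectrum (F : closed_subspace (BC X)) (f : BC X) (xi : R)
    : Prop :=
  ~ exists (U : C -> Prop) (G : C -> Y_space F),
      open U /\ U (Ci * xi)%C /\ analytic_on U G /\
      forall lambda : C, U lambda -> Re lambda <> 0 ->
        G lambda = Rtilde F lambda f.

Definition Lambda_space (F : closed_subspace (BC X)) (Lambda : R -> Prop)
    (a : Y_space F) : Prop :=
  forall f : BC X, a = cls F f ->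
    forall xi : R, reduced_spectrum F f xi -> Lambda xi.

Definition Dtilde_part (F : closed_subspace (BC X)) (Lambda : R -> Prop)
    : operator (Y_space F) :=
  part (Dtilde F) (Lambda_space F Lambda).

End ReducedSpectrum.

Arguments nontrivial {X} F.
Arguments conditionF {X} F.
Arguments Lambda_space {X} F Lambda a.
Arguments Dtilde_part {X} F Lambda _ _.

(* Main.v *)
(* The resolvent [R(l, D)] of the derivation exists off the imaginary axis, with
   norm at most [1 / |Re l|], and descends to the quotient.  If [y] has spectrum in
   [Lambda], its resolvent function extends analytically near every point of the
   imaginary axis off [i Lambda], and [(c - D)^{-1} y] is the value at [c] of
   this extension.  Two points need an argument.

   The spectrum of [t = (c - D)^{-1} y] lies in [Lambda]: by the resolvent identity
   [R(m) t = (t - R(m) y) / (m - c)], which extends wherever [R(m) y] does, also at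
   [c] itself where the singularity is removable.

   The operator [(c - D)^{-1}] is bounded: on a square of centre [c] and half-side
   [d] over which the resolvent function [G] of [y] extends, the maximum principle
   is applied to [((w - c)^2 + d^2) G(w)].  On the boundary the polynomial factor is
   at most [4 d |Re w|] and [|G(w)| <= |y| / |Re w|], whence [|t| <= 4 |y| / d]. *)
Require Import Defs.
From Stdlib Require Import Reals.
From Coquelicot Require Import Coquelicot.
From Stdlib Require Import Lra Lia List Classical ClassicalEpsilon
  FunctionalExtensionality PropExtensionality.

Open Scope R_scope.

(** Since [Dtilde] may be multivalued, the resolvents on the quotient need not be injective. The
    argument is therefore run for an abstract family [Rs] tied to a relation [A] by one equivalence,
    from which the resolvent identity follows without inverting anything.

    Near a point of the axis each [y] brings its own neighbourhood and its own extension. The value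
    at [i eta] is made intrinsic as the limit of [Rs (i eta + s) y] for s decreasing to 0:
    uniqueness of this limit makes the inverse linear and glues the local extensions over a square.
    Closedness of [Lambda] supplies a square size common to all [y], hence a single bound.

    The maximum principle is proved for norms of vector-valued functions by averaging over z + t, z
    + it, z - t, z - it: an expansion of order three with error O(t^4) loses less than the gain 4 k
    t^2 of an added k |w - c|^2. Only such expansions are asked for, and off the axis they come from
    iterating the resolvent identity. *)

Local Notation "c ** x" := (scal (c%C : C_AbsRing) x)
  (at level 40, left associativity).

(** * Linear combinations *)

(** Syntax for proofs by reflection of identities in a complex module; vectors that are not linear
    combinations become numbered atoms. *)
Inductive lin_expr :=
| LZero
| LVar (n : nat)
| LPlus (a b : lin_expr)
| LOpp (a : lin_expr)
| LMinus (a b : lin_expr)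
| LScal (c : C) (a : lin_expr).

Fixpoint lin_coef (e : lin_expr) (n : nat) : C :=
  match e with
  | LZero => RtoC 0
  | LVar m => if Nat.eqb m n then RtoC 1 else RtoC 0
  | LPlus a b => Cplus (lin_coef a n) (lin_coef b n)
  | LOpp a => Copp (lin_coef a n)
  | LMinus a b => Cminus (lin_coef a n) (lin_coef b n)
  | LScal c a => Cmult c (lin_coef a n)
  end.

Section LinEval.
Context {E : CNormedModule}.
Implicit Types (u v w x y z : E) (a b c : C).

Lemma cscal_assoc a b x :
  scal (a : C_AbsRing) (scal (b : C_AbsRing) x) = scal ((a * b)%C : C_AbsRing) x.
Proof. exact (@scal_assoc C_AbsRing E a b x). Qed.

Lemma cscal_one x : scal (RtoC 1 : C_AbsRing) x = x.
Proof. exact (@scal_one C_AbsRing E x). Qed.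

Lemma cscal_zero x : scal (RtoC 0 : C_AbsRing) x = zero.
Proof. exact (@scal_zero_l C_AbsRing E x). Qed.

Lemma cscal_plus a b x : scal ((a + b)%C : C_AbsRing) x =
  plus (scal (a : C_AbsRing) x) (scal (b : C_AbsRing) x).
Proof. exact (@scal_distr_r C_AbsRing E a b x). Qed.

Lemma cscal_m1 x : scal (RtoC (-1) : C_AbsRing) x = opp x.
Proof.
transitivity (scal (opp (@one C_AbsRing)) x); [f_equal|exact (@scal_opp_one C_AbsRing E x)].
unfold opp, one; simpl; unfold RtoC, Copp; simpl; f_equal; lra.
Qed.

(** The axioms of a normed module give only the upper bound; the lower one is the upper bound for
    the inverse scalar. *)
Lemma norm_cscal c x : norm (scal (c : C_AbsRing) x) = (Cmod c * norm x)%R.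
Proof.
apply Rle_antisym; [exact (@norm_scal C_AbsRing E c x)|].
destruct (Ceq_dec c 0) as [->|Hc].
- rewrite Cmod_0, Rmult_0_l; apply norm_ge_0.
- assert (Hm := proj1 (Cmod_gt_0 c) Hc).
  apply Rmult_le_reg_l with (/ Cmod c); [now apply Rinv_0_lt_compat|].
  rewrite <- Rmult_assoc, Rinv_l, Rmult_1_l by lra.
  rewrite <- Cmod_inv by assumption.
  apply Rle_trans with (norm (scal ((/ c)%C : C_AbsRing) (scal (c : C_AbsRing) x))).
  + rewrite cscal_assoc, Cinv_l, cscal_one by assumption; apply Rle_refl.
  + exact (@norm_scal C_AbsRing E (/ c)%C _).
Qed.

Fixpoint lin_eval (env : list E) (e : lin_expr) : E :=
  match e with
  | LZero => zero
  | LVar n => List.nth n env zero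
  | LPlus a b => plus (lin_eval env a) (lin_eval env b)
  | LOpp a => opp (lin_eval env a)
  | LMinus a b => minus (lin_eval env a) (lin_eval env b)
  | LScal c a => scal (c : C_AbsRing) (lin_eval env a)
  end.

Fixpoint lin_sum (f : nat -> C) (env : list E) : E :=
  match env with
  | nil => zero
  | cons x l => plus (scal (f 0%nat : C_AbsRing) x) (lin_sum (fun n => f (S n)) l)
  end.

Lemma lin_sum_ext f g env :
  (forall n, (n < length env)%nat -> f n = g n) -> lin_sum f env = lin_sum g env.
Proof.
revert f g; induction env as [|x l IH]; intros f g H; simpl; trivial.
rewrite (H 0%nat) by (simpl; lia); f_equal; apply IH.
intros n Hn; apply H; simpl; lia.
Qed.

Lemma lin_sum_zero env : lin_sum (fun _ => RtoC 0) env = zero.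
Proof.
induction env as [|x l IH]; simpl; trivial.
rewrite IH, cscal_zero; apply plus_zero_l.
Qed.

Lemma lin_sum_plus f g env :
  lin_sum (fun n => (f n + g n)%C) env = plus (lin_sum f env) (lin_sum g env).
Proof.
revert f g; induction env as [|x l IH]; intros f g; simpl.
- symmetry; apply plus_zero_l.
- rewrite IH, cscal_plus, <- !plus_assoc; f_equal.
  rewrite !plus_assoc; f_equal; apply plus_comm.
Qed.

Lemma lin_sum_scal c f env :
  lin_sum (fun n => (c * f n)%C) env = scal (c : C_AbsRing) (lin_sum f env).
Proof.
revert f; induction env as [|x l IH]; intros f; simpl.
- symmetry; exact (@scal_zero_r C_AbsRing E c).
- rewrite IH, <- cscal_assoc; symmetry; exact (@scal_distr_l C_AbsRing E c _ _).
Qed.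

Lemma lin_sum_var m env :
  lin_sum (lin_coef (LVar m)) env = List.nth m env zero.
Proof.
revert m; induction env as [|x l IH]; intros m; simpl.
- destruct m; reflexivity.
- destruct m as [|m]; simpl.
  + rewrite lin_sum_zero, cscal_one; apply plus_zero_r.
  + rewrite cscal_zero, plus_zero_l; apply (IH m).
Qed.

Lemma lin_evalE env e : lin_eval env e = lin_sum (lin_coef e) env.
Proof.
assert (Hopp : forall f, lin_sum (fun n => Copp (f n)) env = opp (lin_sum f env)).
{ intros f; rewrite <- cscal_m1, <- lin_sum_scal; apply lin_sum_ext.
  intros n _; unfold Copp, Cmult; simpl; rewrite (surjective_pairing (f n)).
  simpl; f_equal; ring. }
induction e as [|m|p IHp q IHq|p IHp|p IHp q IHq|c p IHp];
  cbn [lin_eval lin_coef].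
- symmetry; apply lin_sum_zero.
- symmetry; apply lin_sum_var.
- rewrite IHp, IHq; symmetry; apply lin_sum_plus.
- rewrite IHp; symmetry; apply Hopp.
- rewrite IHp, IHq; unfold Cminus, minus; rewrite <- Hopp; symmetry; apply lin_sum_plus.
- rewrite IHp; symmetry; apply lin_sum_scal.
Qed.

(** A recursive conjunction rather than a bounded quantifier, so that for a concrete list of atoms
    it computes to one scalar equation per atom. *)
Fixpoint lin_coefs_eq (p q : lin_expr) (n : nat) : Prop :=
  match n with
  | O => True
  | S n => lin_coef p n = lin_coef q n /\ lin_coefs_eq p q n
  end.

Lemma lin_eval_eq env p q :
  lin_coefs_eq p q (length env) -> lin_eval env p = lin_eval env q.
Proof.
intros H; rewrite !lin_evalE; apply lin_sum_ext; revert H.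
generalize (length env); induction n as [|n IH]; simpl; intros H m Hm; [lia|].
destruct (Nat.eq_dec m n) as [->|Hd]; [apply H|].
apply IH; [apply H|lia].
Qed.

End LinEval.

Ltac lin_mem x l :=
  match l with
  | nil => constr:(false)
  | cons x _ => constr:(true)
  | cons _ ?l => lin_mem x l
  end.
Ltac lin_add x l :=
  match lin_mem x l with true => l | false => constr:(cons x l) end.
Ltac lin_atoms t l :=
  match t with
  | plus ?a ?b => let l := lin_atoms a l in lin_atoms b l
  | minus ?a ?b => let l := lin_atoms a l in lin_atoms b l
  | opp ?a => lin_atoms a l
  | scal _ ?a => lin_atoms a l
  | zero => l
  | _ => lin_add t l
  end.
Ltac lin_index x l :=
  match l with
  | cons x _ => constr:(0%nat)
  | cons _ ?l => let n := lin_index x l in constr:(S n)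
  end.
Ltac lin_reify t l :=
  match t with
  | plus ?a ?b => let p := lin_reify a l in let q := lin_reify b l in constr:(LPlus p q)
  | minus ?a ?b => let p := lin_reify a l in let q := lin_reify b l in constr:(LMinus p q)
  | opp ?a => let p := lin_reify a l in constr:(LOpp p)
  | scal ?c ?a => let p := lin_reify a l in constr:(LScal c p)
  | zero => constr:(LZero)
  | _ => let n := lin_index t l in constr:(LVar n)
  end.

(* Decides equality of linear combinations by comparing coefficients: leaves
   one equation in [C] per atom. *)
Ltac lin_coefs :=
  match goal with
  | |- @eq ?T ?s ?t =>
    let l := lin_atoms s (@nil T) in
    let l := lin_atoms t l in
    let p := lin_reify s l in
    let q := lin_reify t l in
    change (lin_eval l p = lin_eval l q);
    apply lin_eval_eq;
    cbn [lin_coefs_eq length lin_coef Nat.eqb];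
    repeat split
  end.
Ltac lin_ring := lin_coefs; ring.

(** * Vector-valued power series *)

Local Notation "c ** x" := (scal (c%C : C_AbsRing) x)
  (at level 40, left associativity).

Lemma Cmod_pow_n (u : C) (n : nat) :
  Cmod (pow_n (u : C_AbsRing) n) = Cmod u ^ n.
Proof.
induction n as [|n IH]; simpl; [exact Cmod_1|].
rewrite <- IH; exact (Cmod_mult u _).
Qed.

(** [open] refers to the product topology, whose balls are squares, while analyticity is phrased
    with discs of [Cmod]. This lemma and [open_of_C_ball] translate between the two. *)
Lemma open_C_ball (U : C -> Prop) (z : C) : open U -> U z ->
  exists r, 0 < r /\ forall w, Cmod (w - z) < r -> U w.
Proof.
intros HU Hz; destruct (HU z Hz) as [e He]; exists e; split; [apply cond_pos|].
intros w Hw; apply He; split; unfold ball; simpl; unfold AbsRing_ball;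
  apply Rle_lt_trans with (2 := Hw).
- exact (Rle_trans _ _ _ (Rmax_l _ _) (Rmax_Cmod (w - z)%C)).
- exact (Rle_trans _ _ _ (Rmax_r _ _) (Rmax_Cmod (w - z)%C)).
Qed.

Lemma Cmod_Ci : Cmod Ci = 1.
Proof.
symmetry; unfold Cmod; simpl; rewrite <- sqrt_1 at 1; f_equal; ring.
Qed.

Lemma Cmod_le_abs (z : C) : Cmod z <= Rabs (Re z) + Rabs (Im z).
Proof.
assert (Hz : z = (RtoC (Re z) + Ci * RtoC (Im z))%C).
{ destruct z as [x y]; unfold Cplus, Cmult, RtoC; simpl; f_equal; ring. }
rewrite Hz at 1; apply Rle_trans with (1 := Cmod_triangle _ _).
rewrite Cmod_mult, !Cmod_R.
rewrite Cmod_Ci, Rmult_1_l; apply Rle_refl.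
Qed.

Lemma open_of_C_ball (U : C -> Prop) :
  (forall z, U z -> exists r, 0 < r /\ forall w, Cmod (w - z) < r -> U w) ->
  open U.
Proof.
intros H z Hz; destruct (H z Hz) as [r [Hr K]].
assert (Hr2 : 0 < r / 2) by lra.
exists (mkposreal _ Hr2); intros w [H1 H2]; apply K.
apply Rle_lt_trans with (1 := Cmod_le_abs _).
unfold ball in H1, H2; simpl in H1, H2; unfold AbsRing_ball in H1, H2.
change (Rabs (Re (w - z)) < r / 2) in H1.
change (Rabs (Im (w - z)) < r / 2) in H2; lra.
Qed.

Section PowerSeries.
Context {E : CNormedModule}.
Implicit Types (a b : nat -> E) (u w z : C).

Lemma norm_minus_diag (x : E) : norm (minus x x) = 0.
Proof. rewrite minus_eq_zero; exact (@norm_zero C_AbsRing E). Qed.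

Definition psum a u (n : nat) : E :=
  sum_n (fun k => scal (pow_n (u : C_AbsRing) k) (a k)) n.

Lemma psum_0 a u : psum a u 0 = a 0%nat.
Proof.
unfold psum; rewrite sum_O; exact (@scal_one C_AbsRing E _).
Qed.

Lemma psum_S a u n :
  psum a u (S n) = plus (psum a u n) (scal (pow_n (u : C_AbsRing) (S n)) (a (S n))).
Proof. exact (sum_Sn _ n). Qed.

Lemma is_pseries_psum a u (l : E) :
  is_pseries (K := C_AbsRing) a u l <->
  forall e, 0 < e -> exists N, forall n, (N <= n)%nat -> norm (minus (psum a u n) l) < e.
Proof.
split.
- intros H e He.
  destruct (proj1 (filterlim_locally_ball_norm _ _) H (mkposreal e He)) as [N HN].
  exists N; exact HN.
- intros H; apply (proj2 (filterlim_locally_ball_norm _ _)); intros e.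
  destruct (H e (cond_pos e)) as [N HN]; exists N; exact HN.
Qed.

Lemma is_pseries_at_0 a : is_pseries (K := C_AbsRing) a (RtoC 0) (a 0%nat).
Proof.
apply is_pseries_psum; intros e He; exists 0%nat; intros n _.
replace (psum a 0 n) with (a 0%nat).
- rewrite norm_minus_diag; exact He.
- induction n as [|n IH]; [now rewrite psum_0|].
  rewrite psum_S, <- IH.
  replace (pow_n (RtoC 0 : C_AbsRing) (S n)) with (RtoC 0).
  + rewrite cscal_zero; symmetry; apply plus_zero_r.
  + symmetry; exact (Cmult_0_l _).
Qed.

Lemma is_pseries_uniq a u (l m : E) :
  is_pseries (K := C_AbsRing) a u l -> is_pseries (K := C_AbsRing) a u m -> l = m.
Proof. intros H K; exact (filterlim_locally_unique _ _ _ H K). Qed.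

Lemma pseries_center a (h : C -> E) z (r : posreal) :
  (forall w, Cmod (w - z) < r -> is_pseries (K := C_AbsRing) a (w - z)%C (h w)) ->
  h z = a 0%nat.
Proof.
intros Ha; apply (is_pseries_uniq a (RtoC 0)); [|apply is_pseries_at_0].
replace (RtoC 0) with (z - z)%C by ring; apply Ha.
replace (z - z)%C with (RtoC 0) by ring; rewrite Cmod_0; apply cond_pos.
Qed.

(** A late term is the difference of two partial sums within 1 of the limit, hence at most 2; the
    finitely many early ones are bounded by a maximum. *)
Lemma pseries_coef_bound a (l : E) (r : R) : 0 < r ->
  is_pseries (K := C_AbsRing) a (RtoC r) l ->
  exists M, 0 <= M /\ forall n, norm (a n) * r ^ n <= M.
Proof.
intros Hr H.
destruct (proj1 (is_pseries_psum _ _ _) H 1 Rlt_0_1) as [N HN].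
assert (Hbig : forall n, (N <= n)%nat -> norm (a (S n)) * r ^ S n <= 2).
{ intros n Hn.
  assert (Hterm : scal (pow_n (RtoC r : C_AbsRing) (S n)) (a (S n)) =
    minus (minus (psum a r (S n)) l) (minus (psum a r n) l)).
  { rewrite psum_S; lin_ring. }
  assert (Hnorm : norm (scal (pow_n (RtoC r : C_AbsRing) (S n)) (a (S n))) =
    norm (a (S n)) * r ^ S n).
  { assert (K := norm_cscal (pow_n (RtoC r : C_AbsRing) (S n)) (a (S n))).
    rewrite Cmod_pow_n, Cmod_R, Rabs_pos_eq in K by lra.
    rewrite Rmult_comm; exact K. }
  rewrite <- Hnorm, Hterm; unfold minus at 1.
  apply Rle_trans with (1 := norm_triangle _ _); rewrite norm_opp.
  assert (K1 := HN n Hn); assert (K2 := HN (S n) (le_S _ _ Hn)); lra. }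
assert (Hsmall : forall m, exists M, 0 <= M /\
  forall n, (n <= m)%nat -> norm (a n) * r ^ n <= M).
{ induction m as [|m [M [HM IH]]].
  - exists (norm (a 0%nat) * r ^ 0); split.
    + apply Rmult_le_pos; [apply norm_ge_0|apply pow_le; lra].
    + intros n Hn; replace n with 0%nat by lia; apply Rle_refl.
  - exists (Rmax M (norm (a (S m)) * r ^ S m)); split.
    + apply Rle_trans with (1 := HM), Rmax_l.
    + intros n Hn; destruct (Nat.eq_dec n (S m)) as [->|Hne]; [apply Rmax_r|].
      apply Rle_trans with (2 := Rmax_l _ _), IH; lia. }
destruct (Hsmall N) as [M [HM K]]; exists (Rmax M 2); split.
- apply Rle_trans with (1 := HM), Rmax_l.
- intros n; destruct (Nat.le_gt_cases n N) as [Hn|Hn].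
  + apply Rle_trans with (2 := Rmax_l _ _), K, Hn.
  + destruct n as [|n]; [lia|].
    apply Rle_trans with (2 := Rmax_r _ _), Hbig; lia.
Qed.

(** The clause of [analytic_on] at one point: [analytic_on U h] unfolds to [has_pseries h z] for all
    [z] in [U]. *)
Definition has_pseries (h : C -> E) z : Prop :=
  exists (a : nat -> E) (r : posreal), forall w, Cmod (w - z) < r ->
    is_pseries (K := C_AbsRing) a (w - z)%C (h w).

Lemma has_pseries_ext (h k : C -> E) z (r : R) : 0 < r ->
  (forall w, Cmod (w - z) < r -> h w = k w) -> has_pseries h z -> has_pseries k z.
Proof.
intros Hr Hhk [a [s Hs]].
assert (Hm : 0 < Rmin r s) by (apply Rmin_pos; [exact Hr|apply cond_pos]).
exists a, (mkposreal _ Hm); simpl; intros w Hw; rewrite <- Hhk.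
- apply Hs; apply Rlt_le_trans with (1 := Hw), Rmin_r.
- apply Rlt_le_trans with (1 := Hw), Rmin_l.
Qed.

Lemma has_pseries_plus (h k : C -> E) z :
  has_pseries h z -> has_pseries k z -> has_pseries (fun w => plus (h w) (k w)) z.
Proof.
intros [a [r Ha]] [b [s Hb]].
assert (Hm : 0 < Rmin r s) by (apply Rmin_pos; apply cond_pos).
exists (PS_plus a b), (mkposreal _ Hm); simpl; intros w Hw.
apply (is_pseries_plus (K := C_AbsRing)).
- apply Ha, Rlt_le_trans with (1 := Hw), Rmin_l.
- apply Hb, Rlt_le_trans with (1 := Hw), Rmin_r.
Qed.

Lemma has_pseries_scal (c : C) (h : C -> E) z :
  has_pseries h z -> has_pseries (fun w => c ** h w) z.
Proof.
intros [a [r Ha]]; exists (PS_scal (c : C_AbsRing) a), r; intros w Hw.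
apply (is_pseries_scal (K := C_AbsRing)); [exact (Cmult_comm _ _)|now apply Ha].
Qed.

Lemma has_pseries_const (x : E) z : has_pseries (fun _ => x) z.
Proof.
exists (fun n => match n with O => x | S _ => zero end), (mkposreal 1 Rlt_0_1).
intros w _; apply is_pseries_psum; intros e He; exists 0%nat; intros n _.
replace (psum _ _ n) with x.
- rewrite norm_minus_diag; exact He.
- induction n as [|n IH]; [now rewrite psum_0|].
  rewrite psum_S, <- IH, (@scal_zero_r C_AbsRing E); symmetry; apply plus_zero_r.
Qed.

(* Away from [c], the coefficients of [h w / (w - c)] at [z] solve
   [b n = d * q n + q (n-1)] with [d := z - c]. *)
Lemma has_pseries_div (h : C -> E) (c z : C) : z <> c ->
  has_pseries h z -> has_pseries (fun w => (/ (w - c))%C ** h w) z.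
Proof.
intros Hzc [b [r Hb]].
set (d := (z - c)%C).
assert (Hd0 : d <> RtoC 0) by (intros K; apply Hzc;
  replace z with (d + c)%C by (unfold d; ring); rewrite K; ring).
assert (Hd := proj1 (Cmod_gt_0 d) Hd0).
assert (Hr := cond_pos r).
set (s := r / 2).
destruct (pseries_coef_bound b (h (z + RtoC s)%C) s) as [M [HM HbM]].
{ unfold s; lra. }
{ replace (RtoC s) with ((z + RtoC s) - z)%C at 1 by ring.
  apply Hb; replace ((z + RtoC s) - z)%C with (RtoC s) by ring.
  rewrite Cmod_R, Rabs_pos_eq; unfold s; lra. }
set (q := fix q n : E := match n with
  | O => (/ d)%C ** b 0%nat
  | S m => (/ d)%C ** minus (b (S m)) (q m) end).
set (t := Rmin s (Cmod d / 2)).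
assert (Ht : 0 < t) by (apply Rmin_pos; unfold s; lra).
assert (Hts : t <= s) by apply Rmin_l.
assert (Htd : t <= Cmod d / 2) by apply Rmin_r.
(* [K] solves M + K |d| / 2 = K |d|, so that for t <= |d| / 2 the bound on [q] reproduces itself
   along the recursion. *)
set (K := 2 * M / Cmod d).
assert (HK : 0 <= K) by (unfold K; apply Rdiv_le_0_compat; lra).
assert (HKd : K * Cmod d = 2 * M) by (unfold K; field; lra).
assert (Hbt : forall n, norm (b n) * t ^ n <= M).
{ intros n; apply Rle_trans with (2 := HbM n), Rmult_le_compat_l; [apply norm_ge_0|].
  apply pow_incr; lra. }
assert (Hq : forall n, norm (q n) * t ^ n <= K).
{ induction n as [|n IH]; cbn [q].
  - rewrite norm_cscal, Cmod_inv by assumption.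
    apply Rmult_le_reg_l with (Cmod d); [exact Hd|].
    specialize (Hbt 0%nat); simpl in *.
    replace (Cmod d * (/ Cmod d * norm (b 0%nat) * 1)) with (norm (b 0%nat) * 1)
      by (field; lra); lra.
  - rewrite norm_cscal, Cmod_inv by assumption.
    apply Rmult_le_reg_l with (Cmod d); [exact Hd|].
    specialize (Hbt (S n)).
    assert (Htr : norm (minus (b (S n)) (q n)) <= norm (b (S n)) + norm (q n)).
    { unfold minus; apply Rle_trans with (1 := norm_triangle _ _).
      rewrite norm_opp; apply Rle_refl. }
    assert (Hp : 0 <= t ^ S n) by (apply pow_le; lra).
    apply (Rmult_le_compat_r _ _ _ Hp) in Htr.
    replace (Cmod d * (/ Cmod d * norm (minus (b (S n)) (q n)) * t ^ S n))
      with (norm (minus (b (S n)) (q n)) * t ^ S n) by (field; lra).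
    assert (Hqn : norm (q n) * t ^ S n <= K * (Cmod d / 2)).
    { simpl; replace (norm (q n) * (t * t ^ n)) with (norm (q n) * t ^ n * t) by ring.
      apply Rmult_le_compat; try lra.
      apply Rmult_le_pos; [apply norm_ge_0|apply pow_le; lra]. }
    lra. }
(* Half of [t], so that the terms of the [q] series decay like (1/2)^n. *)
assert (Ht2 : 0 < t / 2) by lra.
exists q, (mkposreal _ Ht2); simpl; intros w Hw.
set (u := (w - z)%C) in *.
assert (Hwc : (w - c)%C = (d + u)%C) by (unfold d, u; ring).
assert (Hdu : Cmod d / 2 <= Cmod (d + u)).
{ assert (T := Cmod_triangle (d + u) (- u)); rewrite Cmod_opp in T.
  replace (d + u + - u)%C with d in T by ring; lra. }
assert (Hdu0 : (d + u)%C <> RtoC 0) by (intros Z; rewrite Z, Cmod_0 in Hdu; lra).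
(* Multiplication by d + u telescopes: the partial sum of [b] comes back with a single extra
   term. *)
assert (Hsum : forall n, (d + u)%C ** psum q u n =
  plus (psum b u n) (scal (pow_n (u : C_AbsRing) (S n)) (q n))).
{ induction n as [|n IH].
  - rewrite !psum_0; cbn [q].
    replace (pow_n (u : C_AbsRing) 1) with u by (symmetry; exact (Cmult_1_r u)).
    lin_coefs; field; assumption.
  - rewrite !psum_S.
    replace (pow_n (u : C_AbsRing) (S (S n))) with (u * pow_n (u : C_AbsRing) (S n))%C
      by reflexivity.
    set (p := pow_n (u : C_AbsRing) (S n)) in *.
    transitivity (plus ((d + u)%C ** psum q u n) (((d + u) * p)%C ** q (S n))).
    { lin_coefs; simpl; ring. }
    rewrite IH; cbn [q]; fold q.
    lin_coefs; simpl; field; assumption. }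
apply is_pseries_psum; intros e He.
assert (Hub : is_pseries (K := C_AbsRing) b u (h w)).
{ apply Hb; fold u; unfold s in *; lra. }
(* Two errors of e |d| / 4 each: division by d + u costs at most a factor 2 / |d|. *)
destruct (proj1 (is_pseries_psum _ _ _) Hub (e * (Cmod d / 4))) as [N HN].
{ apply Rmult_lt_0_compat; lra. }
assert (Hpow : exists N', forall n, (N' <= n)%nat ->
  Cmod u * K * (1 / 2) ^ n < e * (Cmod d / 4)).
{ assert (Hc : 0 < e * (Cmod d / 4) / (Cmod u * K + 1)).
  { apply Rdiv_lt_0_compat; [apply Rmult_lt_0_compat; lra|].
    assert (0 <= Cmod u * K) by (apply Rmult_le_pos; [apply Cmod_ge_0|exact HK]); lra. }
  destruct (pow_lt_1_zero (1 / 2)) with (y := e * (Cmod d / 4) / (Cmod u * K + 1))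
    as [N' HN']; [rewrite Rabs_pos_eq; lra|exact Hc|].
  exists N'; intros n Hn; specialize (HN' n Hn).
  rewrite Rabs_pos_eq in HN' by (apply pow_le; lra).
  assert (Hpos : 0 <= Cmod u * K) by (apply Rmult_le_pos; [apply Cmod_ge_0|exact HK]).
  apply Rle_lt_trans with ((Cmod u * K + 1) * (1 / 2) ^ n).
  - apply Rmult_le_compat_r; [apply pow_le; lra|lra].
  - apply Rmult_lt_reg_l with (/ (Cmod u * K + 1)); [apply Rinv_0_lt_compat; lra|].
    rewrite <- Rmult_assoc, Rinv_l, Rmult_1_l by lra.
    rewrite Rmult_comm; exact HN'. }
destruct Hpow as [N' HN'].
exists (max N N'); intros n Hn.
specialize (HN n (Nat.le_trans _ _ _ (Nat.le_max_l _ _) Hn)).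
specialize (HN' n (Nat.le_trans _ _ _ (Nat.le_max_r _ _) Hn)).
assert (Heq : minus (psum q u n) ((/ (w - c))%C ** h w) =
  (/ (d + u))%C ** plus (minus (psum b u n) (h w))
    (scal (pow_n (u : C_AbsRing) (S n)) (q n))).
{ rewrite Hwc.
  transitivity ((/ (d + u))%C ** minus ((d + u)%C ** psum q u n) (h w)).
  - lin_coefs; field; assumption.
  - rewrite Hsum; lin_coefs; ring. }
rewrite Heq, norm_cscal, Cmod_inv by assumption.
apply Rmult_lt_reg_l with (Cmod (d + u)); [lra|].
rewrite <- Rmult_assoc, Rinv_r, Rmult_1_l by lra.
apply Rle_lt_trans with (1 := norm_triangle _ _).
assert (Hlast : norm (scal (pow_n (u : C_AbsRing) (S n)) (q n)) <=
  Cmod u * K * (1 / 2) ^ n).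
{ assert (T := norm_cscal (pow_n (u : C_AbsRing) (S n)) (q n)).
  rewrite Cmod_pow_n in T; rewrite T.
  replace (Cmod u ^ S n * norm (q n)) with (Cmod u * (norm (q n) * Cmod u ^ n))
    by (simpl; ring).
  rewrite Rmult_assoc; apply Rmult_le_compat_l; [apply Cmod_ge_0|].
  apply Rle_trans with (norm (q n) * (t ^ n * (1 / 2) ^ n)).
  - apply Rmult_le_compat_l; [apply norm_ge_0|].
    rewrite <- Rpow_mult_distr; apply pow_incr; split; [apply Cmod_ge_0|lra].
  - rewrite <- Rmult_assoc; apply Rmult_le_compat_r; [apply pow_le; lra|apply Hq]. }
apply Rlt_le_trans with (e * (Cmod d / 4) + e * (Cmod d / 4)); [lra|].
apply Rle_trans with (e * (Cmod d / 2)); [lra|].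
rewrite Rmult_comm; apply Rmult_le_compat_r; lra.
Qed.

(** The difference quotient at the centre is the series with coefficients shifted by one, and the
    value [x] that fills the gap is the coefficient of degree 1. *)
Lemma has_pseries_shift (h : C -> E) (c : C) : has_pseries h c ->
  exists x, has_pseries (fun w =>
    if Ceq_dec w c then x else (/ (w - c))%C ** minus (h w) (h c)) c.
Proof.
intros [a [r Ha]]; exists (a 1%nat), (fun n => a (S n)), r; intros w Hw.
destruct (Ceq_dec w c) as [->|Hwc].
{ replace (c - c)%C with (RtoC 0) by ring; apply (is_pseries_at_0 (fun n => a (S n))). }
set (u := (w - c)%C) in *.
assert (Hu0 : u <> RtoC 0).
{ intros K; apply Hwc; replace w with (u + c)%C by (unfold u; ring); rewrite K; ring. }
assert (Hu := proj1 (Cmod_gt_0 u) Hu0).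
assert (Hc := pseries_center a h c r Ha).
assert (Hsum : forall n, u ** psum (fun n => a (S n)) u n =
  minus (psum a u (S n)) (a 0%nat)).
{ induction n as [|n IH].
  - rewrite psum_S, !psum_0.
    replace (pow_n (u : C_AbsRing) 1) with u by (symmetry; exact (Cmult_1_r u)).
    lin_ring.
  - rewrite psum_S, (psum_S a u (S n)).
    replace (pow_n (u : C_AbsRing) (S (S n))) with (u * pow_n (u : C_AbsRing) (S n))%C
      by reflexivity.
    set (p := pow_n (u : C_AbsRing) (S n)) in *.
    transitivity (plus (u ** psum (fun n => a (S n)) u n) ((u * p)%C ** a (S (S n)))).
    { lin_coefs; simpl; ring. }
    rewrite IH; lin_coefs; simpl; ring. }
apply is_pseries_psum; intros e He.
destruct (proj1 (is_pseries_psum _ _ _) (Ha w Hw) (e * Cmod u)) as [N HN].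
{ apply Rmult_lt_0_compat; assumption. }
exists N; intros n Hn; specialize (HN (S n) (le_S _ _ Hn)).
replace (minus _ _) with ((/ u)%C ** minus (psum a u (S n)) (h w)).
- rewrite norm_cscal, Cmod_inv by assumption.
  apply Rmult_lt_reg_l with (Cmod u); [exact Hu|].
  rewrite <- Rmult_assoc, Rinv_r, Rmult_1_l, Rmult_comm by lra; fold u in HN; lra.
- transitivity (minus ((/ u)%C ** minus (psum a u (S n)) (a 0%nat))
    ((/ u)%C ** minus (h w) (h c))); [rewrite Hc; lin_ring|].
  rewrite <- Hsum; lin_coefs; field; assumption.
Qed.

(** The regularity that the maximum principle consumes. It survives multiplication by a linear
    factor, and for a resolvent family off the axis it follows from the resolvent identity and the
    norm bound. *)
Definition taylor3 (h : C -> E) z : Prop :=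
  exists (x1 x2 x3 : E) (K r : R), 0 <= K /\ 0 < r /\
  forall u, Cmod u < r ->
    norm (minus (h (z + u)%C) (plus (h z) (plus (u ** x1)
      (plus ((u * u) ** x2) ((u * u * u) ** x3))))) <= K * Cmod u ^ 4.

Lemma taylor3_ext (h k : C -> E) z (r : R) : 0 < r ->
  (forall w, Cmod (w - z) < r -> h w = k w) -> taylor3 h z -> taylor3 k z.
Proof.
intros Hr Hhk [x1 [x2 [x3 [K [s [HK [Hs H]]]]]]].
exists x1, x2, x3, K, (Rmin r s); split; [exact HK|].
split; [apply Rmin_pos; assumption|]; intros u Hu.
assert (Hur : Cmod u < r) by (apply Rlt_le_trans with (1 := Hu), Rmin_l).
assert (Hz := Hhk z); assert (Hzu := Hhk (z + u)%C).
replace (z - z)%C with (RtoC 0) in Hz by ring.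
replace (z + u - z)%C with u in Hzu by ring.
rewrite Cmod_0 in Hz; rewrite <- Hz, <- Hzu by assumption.
apply H, Rlt_le_trans with (1 := Hu), Rmin_r.
Qed.

(** With m = |u| / s <= 1/2, the terms from degree four on are at most M m^4 times a geometric
    series of ratio 1/2, whence the constant 2 M / s^4. *)
Lemma has_pseries_taylor3 (h : C -> E) z : has_pseries h z -> taylor3 h z.
Proof.
intros [a [r Ha]]; assert (Hr := cond_pos r); set (s := r / 2).
assert (Ha' : forall u, Cmod u < r -> is_pseries (K := C_AbsRing) a u (h (z + u)%C)).
{ intros u Hu; replace u with ((z + u) - z)%C at 1 by ring.
  apply Ha; replace ((z + u) - z)%C with u by ring; exact Hu. }
assert (Hs : 0 < s) by (unfold s; lra).
destruct (pseries_coef_bound a (h (z + RtoC s)%C) s Hs) as [M [HM HaM]].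
{ apply Ha'; rewrite Cmod_R, Rabs_pos_eq; unfold s; lra. }
exists (a 1%nat), (a 2%nat), (a 3%nat), (2 * M / s ^ 4), (s / 2).
assert (Hs4 : 0 < s ^ 4) by (apply pow_lt; exact Hs).
split; [apply Rdiv_le_0_compat; lra|split; [lra|]]; intros u Hu.
replace (plus (h z) _) with (psum a u 3).
2:{ rewrite (pseries_center a h z r Ha).
  rewrite !psum_S, psum_0.
  replace (pow_n (u : C_AbsRing) 1) with u by (symmetry; exact (Cmult_1_r u)).
  replace (pow_n (u : C_AbsRing) 2) with (u * u)%C
    by (symmetry; exact (f_equal (Cmult u) (Cmult_1_r u))).
  replace (pow_n (u : C_AbsRing) 3) with (u * (u * u))%C
    by (symmetry; exact (f_equal (fun x => Cmult u (Cmult u x)) (Cmult_1_r u))).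
  lin_ring. }
set (m := Cmod u / s).
assert (Hm : 0 <= m <= 1 / 2).
{ unfold m; split; [apply Rdiv_le_0_compat; [apply Cmod_ge_0|lra]|].
  apply Rmult_le_reg_r with s; [lra|]; unfold Rdiv at 1.
  rewrite Rmult_assoc, Rinv_l by lra; lra. }
replace (2 * M / s ^ 4 * Cmod u ^ 4) with (2 * M * m ^ 4) by (unfold m; field; lra).
assert (Hm4 : 0 <= M * m ^ 4) by (apply Rmult_le_pos; [lra|apply pow_le; lra]).
(* The factor 1 - (1/2)^n closes the induction: the next term costs at most M m^4 (1/2)^n. *)
assert (Htail : forall n, norm (minus (psum a u (n + 3)) (psum a u 3)) <=
  2 * M * m ^ 4 * (1 - (1 / 2) ^ n)).
{ induction n as [|n IH].
  - replace (0 + 3)%nat with 3%nat by reflexivity.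
    rewrite norm_minus_diag; simpl; lra.
  - replace (S n + 3)%nat with (S (n + 3)) by lia; rewrite psum_S.
    set (p := scal (pow_n (u : C_AbsRing) (S (n + 3))) (a (S (n + 3)))).
    assert (Hp : norm p <= M * m ^ 4 * (1 / 2) ^ n).
    { assert (T := norm_cscal (pow_n (u : C_AbsRing) (S (n + 3))) (a (S (n + 3)))).
      unfold p; rewrite Cmod_pow_n in T; rewrite T.
      replace (Cmod u) with (s * m) by (unfold m; field; lra).
      rewrite Rpow_mult_distr.
      replace (m ^ S (n + 3)) with (m ^ n * m ^ 4)
        by (rewrite <- pow_add; f_equal; lia).
      specialize (HaM (S (n + 3))).
      replace (s ^ S (n + 3) * (m ^ n * m ^ 4) * norm (a (S (n + 3)))) with
        ((norm (a (S (n + 3))) * s ^ S (n + 3)) * m ^ 4 * m ^ n) by ring.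
      apply Rmult_le_compat; [| |apply Rmult_le_compat_r; [|exact HaM]|].
      - apply Rmult_le_pos; [apply Rmult_le_pos; [apply norm_ge_0|]|]; apply pow_le; lra.
      - apply pow_le; lra.
      - apply pow_le; lra.
      - apply pow_incr; lra. }
    replace (minus (plus (psum a u (n + 3)) p) (psum a u 3)) with
      (plus (minus (psum a u (n + 3)) (psum a u 3)) p) by lin_ring.
    apply Rle_trans with (1 := norm_triangle _ _).
    simpl pow at 2; simpl pow in IH, Hp |- *; lra. }
apply le_epsilon; intros e He.
assert (Hu' : Cmod u < r) by (unfold s in *; lra).
destruct (proj1 (is_pseries_psum _ _ _) (Ha' u Hu') e He) as [N HN].
specialize (HN (N + 3)%nat (Nat.le_add_r _ _)); specialize (Htail N).
replace (minus (h (z + u)%C) (psum a u 3)) with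
  (minus (minus (psum a u (N + 3)) (psum a u 3)) (minus (psum a u (N + 3)) (h (z + u)%C)))
  by lin_ring.
unfold minus at 1; apply Rle_trans with (1 := norm_triangle _ _); rewrite norm_opp.
assert (0 <= 2 * M * m ^ 4 * (1 / 2) ^ N).
{ apply Rmult_le_pos; [lra|apply pow_le; lra]. }
lra.
Qed.

End PowerSeries.

(** * The maximum principle *)

Section MaximumPrinciple.

Definition square (c : C) (d : R) (w : C) : Prop :=
  Re c - d <= Re w <= Re c + d /\ Im c - d <= Im w <= Im c + d.

Lemma list_max (T : Type) (f : T -> R) (l : list T) :
  l <> nil -> exists x, In x l /\ forall y, In y l -> f y <= f x.
Proof.
induction l as [|x l IH]; [easy|intros _].
destruct l as [|x' l'].
- exists x; split; [now left|intros y [->|[]]; apply Rle_refl].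
- destruct IH as [m [Hm Hmax]]; [easy|].
  destruct (Rle_lt_dec (f x) (f m)) as [H|H].
  + exists m; split; [now right|intros y [<-|Hy]; auto].
  + exists x; split; [now left|intros y [<-|Hy]; [apply Rle_refl|]].
    apply Rle_trans with (1 := Hmax y Hy); lra.
Qed.

(** Upper semicontinuity is enough. Without a maximum, each point has a neighbourhood on which [phi]
    stays below its value at some better point. Finitely many neighbourhoods cover the square, and
    the best of the corresponding better points lies in one of them, hence is beaten by another. *)
Lemma square_max (phi : C -> R) (c : C) (d : R) : 0 <= d ->
  (forall z, square c d z -> forall e, 0 < e -> exists r, 0 < r /\
     forall w, Rabs (Re w - Re z) < r -> Rabs (Im w - Im z) < r -> phi w < phi z + e) ->
  exists z, square c d z /\ forall w, square c d w -> phi w <= phi z.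
Proof.
intros Hd Husc; apply NNPP; intros Hno.
assert (Hbetter : forall z, exists p : posreal * C, square c d z ->
  square c d (snd p) /\ forall w, Rabs (Re w - Re z) < fst p ->
    Rabs (Im w - Im z) < fst p -> phi w < phi (snd p)).
{ intros z; destruct (classic (square c d z)) as [Hz|Hz].
  2:{ exists (mkposreal 1 Rlt_0_1, z); intros K; contradiction. }
  destruct (classic (exists w, square c d w /\ phi z < phi w)) as [[w [Hw Hlt]]|Hn].
  - destruct (Husc z Hz (phi w - phi z)) as [r [Hr Hr']]; [lra|].
    exists (mkposreal r Hr, w); intros _; split; [exact Hw|].
    intros v H1 H2; specialize (Hr' v H1 H2); simpl; lra.
  - exfalso; apply Hno; exists z; split; [exact Hz|]; intros w Hw.
    apply Rnot_lt_le; intros K; apply Hn; exists w; split; assumption. }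
destruct (choice _ Hbetter) as [p Hp].
(* Points of the box are nested pairs ending in [unit]; [toC] reads them as complex numbers. *)
set (toC := fun t : Compactness.Tn 2 R => ((fst t, fst (snd t)) : C)).
(* The finite cover comes under a double negation, which is harmless because the goal is [False]. *)
apply (compactness_list 2 (Re c - d, (Im c - d, tt)) (Re c + d, (Im c + d, tt))
  (fun t => fst (p (toC t)))); intros [l Hl].
assert (Hcover : forall w, square c d w -> exists t, In t l /\ square c d (toC t) /\
  phi w < phi (snd (p (toC t)))).
{ intros [x y] [Hx Hy]; destruct (Hl (x, (y, tt))) as [[u [v []]] [Hin [[Hu [Hv _]] [Cu [Cv _]]]]].
  - simpl in *; auto.
  - exists (u, (v, tt)); repeat split; try exact Hin; try apply Hu; try apply Hv.
    apply (Hp (toC (u, (v, tt)))); [split; assumption| |]; assumption. }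
assert (Hc : square c d c) by (unfold square; split; lra).
(* The list may contain tags outside the square, about which [Hp] says nothing. *)
set (good := filter (fun t => if excluded_middle_informative (square c d (toC t))
  then true else false) l).
assert (Hgood : forall t, In t good <-> In t l /\ square c d (toC t)).
{ intros t; unfold good; rewrite filter_In.
  destruct (excluded_middle_informative _); intuition congruence. }
destruct (Hcover c Hc) as [t0 [Ht0 [Hs0 _]]].
destruct (list_max _ (fun t => phi (snd (p (toC t)))) good) as [t [Ht Hmax]].
{ intros K; assert (G := proj2 (Hgood t0) (conj Ht0 Hs0)); rewrite K in G; exact G. }
apply Hgood in Ht; destruct Ht as [_ Hst].
destruct (Hcover (snd (p (toC t)))) as [t' [Hin' [Hs' Hlt]]].
{ apply Hp, Hst. }
specialize (Hmax t' (proj2 (Hgood t') (conj Hin' Hs'))); lra.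
Qed.

Context {E : CNormedModule}.
Implicit Types (h : C -> E) (u w z c : C).

Lemma norm_minus_le (x y : E) : norm (minus x y) <= norm x + norm y.
Proof.
unfold minus; apply Rle_trans with (1 := norm_triangle _ _).
rewrite norm_opp; apply Rle_refl.
Qed.

Lemma norm_le_minus (x y : E) : norm x <= norm y + norm (minus x y).
Proof.
replace x with (plus y (minus x y)) at 1 by lin_ring; exact (norm_triangle _ _).
Qed.

Lemma norm_minus_sym (x y : E) : norm (minus x y) = norm (minus y x).
Proof.
replace (minus x y) with (opp (minus y x)) by lin_ring; apply norm_opp.
Qed.

Lemma norm_minus_le0 (x y : E) : norm (minus x y) <= 0 -> x = y.
Proof.
intros H; replace x with (plus (minus x y) y) by lin_ring.
replace (minus x y) with (zero : E); [apply plus_zero_l|].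
symmetry; apply (@norm_eq_zero C_AbsRing E), Rle_antisym; [exact H|apply norm_ge_0].
Qed.

(** The factor is d + u with d = z - b, so each new coefficient is d times the old one plus its
    predecessor. The stray u^4 [x3] joins the error, and |u| < 1 bounds |d + u| by |d| + 1. *)
Lemma taylor3_mul h (b z : C) :
  taylor3 h z -> taylor3 (fun w => (w - b)%C ** h w) z.
Proof.
intros [x1 [x2 [x3 [K [r [HK [Hr H]]]]]]]; set (d := (z - b)%C).
exists (plus (d ** x1) (h z)), (plus (d ** x2) x1), (plus (d ** x3) x2).
exists ((Cmod d + 1) * K + norm x3), (Rmin r 1).
assert (Hd := Cmod_ge_0 d).
split; [apply Rplus_le_le_0_compat; [apply Rmult_le_pos; lra|apply norm_ge_0]|].
split; [apply Rmin_pos; lra|]; intros u Hu.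
assert (Hu0 := Cmod_ge_0 u).
specialize (H u (Rlt_le_trans _ _ _ Hu (Rmin_l _ _))).
set (p := plus (h z) _) in H.
cbn beta; fold d; replace (z + u - b)%C with (d + u)%C by (unfold d; ring).
replace (minus _ _) with
  (plus ((d + u)%C ** minus (h (z + u)%C) p) ((u * u * u * u)%C ** x3)).
2:{ unfold p; lin_ring. }
apply Rle_trans with (1 := norm_triangle _ _); rewrite !norm_cscal, !Cmod_mult.
rewrite Rmult_plus_distr_r; apply Rplus_le_compat.
- rewrite Rmult_assoc; apply Rmult_le_compat; try apply Cmod_ge_0; try apply norm_ge_0.
  + apply Rle_trans with (1 := Cmod_triangle _ _).
    assert (T := Rmin_r r 1); lra.
  + exact H.
- apply Req_le; ring.
Qed.

Lemma taylor3_lipschitz h z : taylor3 h z ->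
  exists L r, 0 <= L /\ 0 < r /\
    forall u, Cmod u < r -> norm (minus (h (z + u)%C) (h z)) <= L * Cmod u.
Proof.
intros [x1 [x2 [x3 [K [r [HK [Hr H]]]]]]].
assert (H1 := norm_ge_0 x1); assert (H2 := norm_ge_0 x2); assert (H3 := norm_ge_0 x3).
exists (norm x1 + norm x2 + norm x3 + K), (Rmin r 1).
split; [lra|split; [apply Rmin_pos; lra|]]; intros u Hu.
specialize (H u (Rlt_le_trans _ _ _ Hu (Rmin_l _ _))).
assert (Hu1 : Cmod u < 1) by exact (Rlt_le_trans _ _ _ Hu (Rmin_r _ _)).
assert (Hu0 := Cmod_ge_0 u).
set (p := plus (h z) _) in H.
replace (minus (h (z + u)%C) (h z)) with (plus (minus (h (z + u)%C) p)
  (plus (u ** x1) (plus ((u * u)%C ** x2) ((u * u * u)%C ** x3))))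
  by (unfold p; lin_ring).
apply Rle_trans with (1 := norm_triangle _ _).
assert (T : norm (plus (u ** x1) (plus ((u * u)%C ** x2) ((u * u * u)%C ** x3))) <=
  Cmod u * norm x1 + (Cmod u * Cmod u * norm x2 + Cmod u * Cmod u * Cmod u * norm x3)).
{ apply Rle_trans with (1 := norm_triangle _ _); apply Rplus_le_compat.
  - rewrite norm_cscal; apply Rle_refl.
  - apply Rle_trans with (1 := norm_triangle _ _).
    rewrite !norm_cscal, !Cmod_mult; apply Rle_refl. }
set (m := Cmod u) in *.
assert (Hmm : m * m <= m) by (rewrite <- (Rmult_1_r m) at 3; apply Rmult_le_compat_l; lra).
assert (Hmmm : m * m * m <= m).
{ rewrite <- (Rmult_1_r m) at 4; apply Rmult_le_compat; try lra.
  apply Rmult_le_pos; lra. }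
assert (Hm4 : m ^ 4 <= m).
{ simpl; replace (m * (m * (m * (m * 1)))) with (m * (m * m * m)) by ring.
  rewrite <- (Rmult_1_r m) at 5; apply Rmult_le_compat_l; lra. }
apply (Rmult_le_compat_r _ _ _ H2) in Hmm.
apply (Rmult_le_compat_r _ _ _ H3) in Hmmm.
apply (Rmult_le_compat_l _ _ _ HK) in Hm4.
replace ((norm x1 + norm x2 + norm x3 + K) * m) with
  (K * m + (m * norm x1 + (m * norm x2 + m * norm x3))) by ring; lra.
Qed.

(* Averaging over the fourth roots of unity kills the terms of degree 1, 2, 3. *)
Lemma four_point_mean h z : taylor3 h z ->
  exists K r, 0 <= K /\ 0 < r /\ forall t : R, 0 < t < r ->
    4 * norm (h z) <= norm (h (z + RtoC t)%C) + norm (h (z + Ci * RtoC t)%C) +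
      norm (h (z + RtoC (- t))%C) + norm (h (z + Ci * RtoC (- t))%C) + K * t ^ 4.
Proof.
intros H; destruct H as [x1 [x2 [x3 [K [r [HK [Hr T]]]]]]].
exists (4 * K), r; split; [lra|split; [exact Hr|]]; intros t Ht.
set (p := fun u : C => plus (h z) (plus (u ** x1)
      (plus ((u * u)%C ** x2) ((u * u * u)%C ** x3)))).
assert (Hm : Cmod (RtoC t) = t) by (rewrite Cmod_R, Rabs_pos_eq; lra).
assert (Hm' : Cmod (RtoC (- t)) = t) by (rewrite Cmod_R, Rabs_Ropp, Rabs_pos_eq; lra).
assert (Hi : Cmod (Ci * RtoC t) = t) by (rewrite Cmod_mult, Cmod_Ci, Hm; ring).
assert (Hi' : Cmod (Ci * RtoC (- t)) = t) by (rewrite Cmod_mult, Cmod_Ci, Hm'; ring).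
assert (T1 := T (RtoC t)); assert (T2 := T (Ci * RtoC t)%C).
assert (T3 := T (RtoC (- t))); assert (T4 := T (Ci * RtoC (- t))%C).
rewrite Hm in T1; rewrite Hm' in T3; rewrite Hi in T2; rewrite Hi' in T4.
specialize (T1 (proj2 Ht)); specialize (T2 (proj2 Ht)).
specialize (T3 (proj2 Ht)); specialize (T4 (proj2 Ht)).
fold (p (RtoC t)) in T1; fold (p (Ci * RtoC t)%C) in T2.
fold (p (RtoC (- t))) in T3; fold (p (Ci * RtoC (- t))%C) in T4.
assert (Hp : plus (plus (p (RtoC t)) (p (Ci * RtoC t)%C))
  (plus (p (RtoC (- t))) (p (Ci * RtoC (- t))%C)) = (RtoC 4) ** h z).
{ unfold p; rewrite RtoC_opp; lin_coefs.
  all: unfold Ci, RtoC, Cmult, Cplus, Copp; simpl; f_equal; ring. }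
assert (H4 : 4 * norm (h z) = norm (RtoC 4 ** h z)).
{ rewrite norm_cscal, Cmod_R, Rabs_pos_eq; lra. }
rewrite H4, <- Hp.
apply Rle_trans with (1 := norm_triangle _ _).
assert (N1 := norm_triangle (p (RtoC t)) (p (Ci * RtoC t)%C)).
assert (N2 := norm_triangle (p (RtoC (- t))) (p (Ci * RtoC (- t))%C)).
rewrite norm_minus_sym in T1, T2, T3, T4.
assert (M1 := norm_le_minus (p (RtoC t)) (h (z + RtoC t)%C)).
assert (M2 := norm_le_minus (p (Ci * RtoC t)%C) (h (z + Ci * RtoC t)%C)).
assert (M3 := norm_le_minus (p (RtoC (- t))) (h (z + RtoC (- t))%C)).
assert (M4 := norm_le_minus (p (Ci * RtoC (- t))%C) (h (z + Ci * RtoC (- t))%C)).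
lra.
Qed.

Lemma sqr_plus_le (s : R) : 0 < s -> s <= 1 -> forall x a, Rabs a < s ->
  (x + a) ^ 2 <= x ^ 2 + s * (2 * Rabs x + 1).
Proof.
intros Hs Hs1 x a Ha.
assert (H1 : x * a <= Rabs x * s).
{ apply Rle_trans with (1 := Rle_abs _); rewrite Rabs_mult.
  apply Rmult_le_compat_l; [apply Rabs_pos|lra]. }
assert (H2 : a ^ 2 <= s).
{ rewrite <- pow2_abs; simpl.
  assert (H0 := Rabs_pos a).
  apply Rle_trans with (s * 1); [|lra].
  rewrite Rmult_1_r; apply Rmult_le_compat; lra. }
replace ((x + a) ^ 2) with (x ^ 2 + 2 * (x * a) + a ^ 2) by ring; lra.
Qed.

(** The penalty k |w - c|^2 forbids interior maxima: at one, the four-point mean would give 4 k t^2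
    <= K t^4 for all small t. The maximum is thus on the boundary, where the penalty is at most
    e. *)
Lemma maximum_principle h c (d B : R) : 0 < d ->
  (forall z, square c d z -> taylor3 h z) ->
  (forall z, square c d z -> Rabs (Re z - Re c) = d \/ Rabs (Im z - Im c) = d ->
     norm (h z) <= B) ->
  norm (h c) <= B.
Proof.
intros Hd Hh HB; apply le_epsilon; intros e He.
(* On the square |w - c|^2 <= 2 d^2, so the penalty stays below e. *)
set (k := e / (2 * d ^ 2)).
assert (Hd2 : 0 < d ^ 2) by (apply pow_lt; exact Hd).
assert (Hk : 0 < k) by (apply Rdiv_lt_0_compat; lra).
set (q := fun w : C => (Re w - Re c) ^ 2 + (Im w - Im c) ^ 2).
destruct (square_max (fun w => norm (h w) + k * q w) c d) as [z [Hz Hmax]].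
- lra.
- intros z Hz e' He'.
  destruct (taylor3_lipschitz h z (Hh z Hz)) as [L [r [HL [Hr Hlip]]]].
  set (x := Re z - Re c); set (y := Im z - Im c).
  assert (Hx := Rabs_pos x); assert (Hy := Rabs_pos y).
  (* Growth per unit of [s]: 2 L since |w - z| <= 2 s, then the modulus of the penalty; the final 1
     makes the inequality strict. *)
  set (A := 2 * L + k * (2 * Rabs x + 1 + (2 * Rabs y + 1)) + 1).
  assert (HkA : 0 <= k * (2 * Rabs x + 1 + (2 * Rabs y + 1)))
    by (apply Rmult_le_pos; lra).
  assert (HA : 0 < A) by (unfold A; lra).
  set (s := Rmin (r / 2) (Rmin 1 (e' / A))).
  assert (Hs : 0 < s).
  { repeat apply Rmin_pos; try lra; apply Rdiv_lt_0_compat; lra. }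
  assert (Hs1 : s <= r / 2) by apply Rmin_l.
  assert (Hs2 : s <= 1) by (unfold s; eapply Rle_trans; [apply Rmin_r|apply Rmin_l]).
  assert (Hs3 : s <= e' / A) by (unfold s; eapply Rle_trans; [apply Rmin_r|apply Rmin_r]).
  exists s; split; [exact Hs|]; intros w Hwx Hwy.
  set (a := Re w - Re z) in *; set (b := Im w - Im z) in *.
  assert (Hu : Cmod (w - z) <= Rabs a + Rabs b) by exact (Cmod_le_abs (w - z)%C).
  assert (Hur : Cmod (w - z) < r) by lra.
  specialize (Hlip (w - z)%C Hur).
  replace (z + (w - z))%C with w in Hlip by ring.
  assert (Hnw := norm_le_minus (h w) (h z)).
  assert (HLs : L * Cmod (w - z) <= 2 * L * s).
  { replace (2 * L * s) with (L * (s + s)) by ring.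
    apply Rmult_le_compat_l; lra. }
  assert (Hsq := sqr_plus_le s Hs Hs2).
  assert (Hqx := Hsq x a Hwx); assert (Hqy := Hsq y b Hwy).
  assert (Hq : q w <= q z + s * (2 * Rabs x + 1 + (2 * Rabs y + 1))).
  { unfold q; fold x y.
    replace (Re w - Re c) with (x + a) by (unfold x, a; ring).
    replace (Im w - Im c) with (y + b) by (unfold y, b; ring); lra. }
  apply (Rmult_le_compat_l k) in Hq; [|lra].
  assert (HsA : s * A <= e').
  { apply (Rmult_le_compat_r A) in Hs3; [|lra].
    unfold Rdiv in Hs3; rewrite Rmult_assoc, Rinv_l, Rmult_1_r in Hs3 by lra; exact Hs3. }
  unfold A in HsA; lra.
- assert (Hc : square c d c) by (unfold square; split; lra).
  assert (Hqc : q c = 0) by (unfold q; ring).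
  assert (Hmc := Hmax c Hc); rewrite Hqc in Hmc.
  destruct Hz as [Hzx Hzy].
  assert (Hqz : k * q z <= e).
  { replace e with (k * (d ^ 2 + d ^ 2)) by (unfold k; field; lra).
    apply Rmult_le_compat_l; [lra|]; unfold q.
    apply Rplus_le_compat; apply pow_maj_Rabs, Rabs_le; lra. }
  destruct (classic (Rabs (Re z - Re c) = d \/ Rabs (Im z - Im c) = d)) as [Hb|Hi].
  { specialize (HB z (conj Hzx Hzy) Hb); lra. }
  exfalso.
  assert (Hix : Rabs (Re z - Re c) < d).
  { destruct (Rabs_le (Re z - Re c) d) as [Hl|Hl]; [lra|exact Hl|]; exfalso; auto. }
  assert (Hiy : Rabs (Im z - Im c) < d).
  { destruct (Rabs_le (Im z - Im c) d) as [Hl|Hl]; [lra|exact Hl|]; exfalso; auto. }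
  destruct (four_point_mean h z (Hh z (conj Hzx Hzy))) as [K [r [HK [Hr H4]]]].
  set (m := Rmin (d - Rabs (Re z - Re c)) (d - Rabs (Im z - Im c))).
  (* [r] keeps the expansion valid and [m] keeps the four points in the square; the last two bounds
     give K t^2 <= k, which contradicts 4 k t^2 <= K t^4. *)
  set (t := Rmin (Rmin (r / 2) m) (Rmin 1 (k / (K + 1)))).
  assert (Hm : 0 < m) by (apply Rmin_pos; lra).
  assert (Ht : 0 < t).
  { apply Rmin_pos; [apply Rmin_pos; [lra|exact Hm]|].
    apply Rmin_pos; [lra|apply Rdiv_lt_0_compat; lra]. }
  assert (Ht1 : t <= r / 2)
    by (unfold t; eapply Rle_trans; [apply Rmin_l|apply Rmin_l]).
  assert (Ht2 : t <= m)
    by (unfold t; eapply Rle_trans; [apply Rmin_l|apply Rmin_r]).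
  assert (Ht3 : t <= 1)
    by (unfold t; eapply Rle_trans; [apply Rmin_r|apply Rmin_l]).
  assert (Ht4 : t <= k / (K + 1))
    by (unfold t; eapply Rle_trans; [apply Rmin_r|apply Rmin_r]).
  assert (Hmx : t <= d - Rabs (Re z - Re c)) by (apply Rle_trans with (1 := Ht2), Rmin_l).
  assert (Hmy : t <= d - Rabs (Im z - Im c)) by (apply Rle_trans with (1 := Ht2), Rmin_r).
  apply Rabs_def2 in Hix; apply Rabs_def2 in Hiy.
  assert (Ax := Rle_abs (Re z - Re c)); assert (Ay := Rle_abs (Im z - Im c)).
  assert (Bx := Rle_abs (- (Re z - Re c))); assert (By := Rle_abs (- (Im z - Im c))).
  rewrite Rabs_Ropp in Bx, By.
  assert (Hre : forall s : R, Re (z + RtoC s) = Re z + s) by (intros s; reflexivity).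
  assert (Him : forall s : R, Im (z + RtoC s) = Im z)
    by (intros s; apply Rplus_0_r).
  assert (Hre' : forall s : R, Re (z + Ci * RtoC s) = Re z)
    by (intros s; unfold Re; simpl; ring).
  assert (Him' : forall s : R, Im (z + Ci * RtoC s) = Im z + s)
    by (intros s; unfold Im; simpl; ring).
  assert (M1 := Hmax (z + RtoC t)%C); assert (M2 := Hmax (z + Ci * RtoC t)%C).
  assert (M3 := Hmax (z + RtoC (- t))%C); assert (M4 := Hmax (z + Ci * RtoC (- t))%C).
  unfold square, q in M1, M2, M3, M4.
  rewrite Hre, Him in M1, M3; rewrite Hre', Him' in M2, M4.
  specialize (M1 ltac:(lra)); specialize (M2 ltac:(lra)).
  specialize (M3 ltac:(lra)); specialize (M4 ltac:(lra)).
  specialize (H4 t ltac:(lra)).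
  assert (Hkt : 4 * (k * t ^ 2) <= K * t ^ 4) by lra.
  assert (Ht2' : 0 < t ^ 2) by (apply pow_lt; exact Ht).
  assert (HKt : K * t ^ 2 <= k).
  { apply (Rmult_le_compat_r (K + 1)) in Ht4; [|lra].
    unfold Rdiv in Ht4; rewrite Rmult_assoc, Rinv_l, Rmult_1_r in Ht4 by lra.
    apply Rle_trans with (2 := Ht4); simpl.
    replace (K * (t * (t * 1))) with (t * t * K) by ring.
    apply Rmult_le_compat; try lra.
    rewrite <- (Rmult_1_r t) at 3; apply Rmult_le_compat_l; lra. }
  apply (Rmult_le_compat_r (t ^ 2)) in HKt; [|lra].
  replace (K * t ^ 2 * t ^ 2) with (K * t ^ 4) in HKt by ring.
  assert (0 < k * t ^ 2) by (apply Rmult_lt_0_compat; lra); lra.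
Qed.

End MaximumPrinciple.

(** * Spectra of resolvent families *)

Section PseudoResolvent.
(** [A_Rs] says that [Rs l] is the inverse of l - A as a relation: it allows [A] to be multivalued
    and [Rs l] to have a kernel. *)
Context {E : CNormedModule} (Rs : C -> E -> E) (A : operator E).
Context (Rs_plus : forall l x y, Re l <> 0 -> Rs l (plus x y) = plus (Rs l x) (Rs l y)).
Context (Rs_scal : forall l (k : C) x, Re l <> 0 -> Rs l (k ** x) = k ** Rs l x).
Context (Rs_bound : forall l x, Re l <> 0 -> norm (Rs l x) <= norm x / Rabs (Re l)).
Context (A_Rs : forall l x z, Re l <> 0 -> A x z <-> x = Rs l (minus (l ** x) z)).
Implicit Types (l m c : C) (x y z t : E) (eta xi : R).

Lemma scal_cancel (k : C) x y : k <> RtoC 0 -> k ** x = k ** y -> x = y.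
Proof.
intros Hk H; rewrite <- (cscal_one x), <- (cscal_one y), <- (Cinv_l k Hk).
rewrite <- !cscal_assoc, H; reflexivity.
Qed.

(** By [A_Rs] at m, [A] relates R(m) x to m R(m) x - x. Read back at l, this is R(m) x = R(l) ((l -
    m) R(m) x + x). *)
Lemma resolvent_identity l m x : Re l <> 0 -> Re m <> 0 ->
  (m - l) ** Rs l (Rs m x) = minus (Rs l x) (Rs m x).
Proof.
intros Hl Hm.
assert (HA : A (Rs m x) (minus (m ** Rs m x) x)).
{ apply (A_Rs m); [exact Hm|]; f_equal; lin_ring. }
apply (A_Rs l) in HA; [|exact Hl].
replace (minus (l ** Rs m x) _) with (plus ((l - m) ** Rs m x) x) in HA by lin_ring.
rewrite Rs_plus, Rs_scal in HA by exact Hl.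
transitivity (minus (Rs l x) (plus ((l - m) ** Rs l (Rs m x)) (Rs l x))); [lin_ring|].
exact (f_equal (minus (Rs l x)) (eq_sym HA)).
Qed.

(** Exchanging l and m changes the sign of both m - l and the right side of the resolvent
    identity. *)
Lemma Rs_comm l m x : Re l <> 0 -> Re m <> 0 -> Rs l (Rs m x) = Rs m (Rs l x).
Proof.
intros Hl Hm; destruct (Ceq_dec l m) as [->|Hlm]; [reflexivity|].
apply (scal_cancel (m - l)%C).
- intros H; apply Hlm; replace m with ((m - l) + l)%C by ring; rewrite H; ring.
- rewrite resolvent_identity by assumption.
  transitivity (opp ((l - m) ** Rs m (Rs l x))); [|lin_ring].
  rewrite resolvent_identity by assumption; lin_ring.
Qed.

Lemma Rs_minus l x y : Re l <> 0 -> Rs l (minus x y) = minus (Rs l x) (Rs l y).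
Proof.
intros Hl; replace (minus x y) with (plus x ((- (1))%C ** y)) by lin_ring.
rewrite Rs_plus, Rs_scal by exact Hl; lin_ring.
Qed.

(** The property negated in [reduced_spectrum], with the family acting on vectors instead of
    representatives. *)
Definition regular_at x eta : Prop :=
  exists (U : C -> Prop) (G : C -> E),
    open U /\ U (Ci * eta)%C /\ analytic_on U G /\
    forall l, U l -> Re l <> 0 -> G l = Rs l x.

Lemma regular_at_plus x y eta :
  regular_at x eta -> regular_at y eta -> regular_at (plus x y) eta.
Proof.
intros [U [G [HU [HUe [HG HGe]]]]] [V [H [HV [HVe [HH HHe]]]]].
exists (fun w => U w /\ V w), (fun w => plus (G w) (H w)).
split; [apply open_and; assumption|split; [split; assumption|split]].
- intros w [Hw1 Hw2]; exact (has_pseries_plus _ _ _ (HG w Hw1) (HH w Hw2)).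
- intros l [H1 H2] Hl; rewrite HGe, HHe, Rs_plus; trivial.
Qed.

Lemma regular_at_scal (k : C) x eta : regular_at x eta -> regular_at (k ** x) eta.
Proof.
intros [U [G [HU [HUe [HG HGe]]]]].
exists U, (fun w => k ** G w); split; [|split; [|split]]; trivial.
- intros w Hw; exact (has_pseries_scal _ _ _ (HG w Hw)).
- intros l H1 Hl; rewrite HGe, Rs_scal; trivial.
Qed.

Lemma regular_at_minus x y eta :
  regular_at x eta -> regular_at y eta -> regular_at (minus x y) eta.
Proof.
intros Hx Hy; replace (minus x y) with (plus x ((- (1))%C ** y)) by lin_ring.
apply regular_at_plus; [exact Hx|apply regular_at_scal, Hy].
Qed.

(* [t] plays the role of [(c - A)^{-1} y], through the resolvent identity. *)
Definition shifted_resolvent c y t : Prop :=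
  forall m, Re m <> 0 -> (m - c) ** Rs m t = minus t (Rs m y).

Lemma shifted_resolvent_inv c y t m : shifted_resolvent c y t -> Re m <> 0 -> m <> c ->
  (/ (m - c))%C ** minus t (Rs m y) = Rs m t.
Proof.
intros H Hm Hmc; rewrite <- H by exact Hm; lin_coefs; field.
intros K; apply Hmc; replace m with ((m - c) + c)%C by ring; rewrite K; ring.
Qed.

Lemma has_pseries_quotient (G : C -> E) c t w : w <> c -> has_pseries G w ->
  has_pseries (fun v => (/ (v - c))%C ** minus t (G v)) w.
Proof.
intros Hwc HG; apply has_pseries_div; [exact Hwc|].
apply (has_pseries_ext (fun v => plus t ((- (1))%C ** G v)) _ _ 1 Rlt_0_1).
- intros v _; lin_ring.
- apply has_pseries_plus; [apply has_pseries_const|apply has_pseries_scal, HG].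
Qed.

(** Once [c] is removed from [U], the quotient (t - G v) / (v - c) is analytic on the rest, which
    still contains [i eta]. *)
Lemma regular_at_shifted_off c y t eta : (Ci * eta)%C <> c ->
  shifted_resolvent c y t -> regular_at y eta -> regular_at t eta.
Proof.
intros Hc Ht [U [G [HU [HUe [HG HGe]]]]].
exists (fun w => U w /\ w <> c), (fun v => (/ (v - c))%C ** minus t (G v)).
split; [|split; [split; assumption|split]].
- apply open_of_C_ball; intros z [Hz Hzc].
  destruct (open_C_ball U z HU Hz) as [r [Hr HrU]].
  assert (Hd : 0 < Cmod (c - z)).
  { apply Cmod_gt_0; intros K; apply Hzc.
    replace z with (c - (c - z))%C by ring; rewrite K; ring. }
  exists (Rmin r (Cmod (c - z))); split; [apply Rmin_pos; assumption|].
  intros w Hw; split; [apply HrU, Rlt_le_trans with (1 := Hw), Rmin_l|].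
  intros ->; apply Rlt_not_le in Hw; apply Hw, Rmin_r.
- intros w [Hw Hwc]; exact (has_pseries_quotient G c t w Hwc (HG w Hw)).
- intros l [Hl Hlc] Hl0; cbn beta; rewrite HGe by assumption.
  apply shifted_resolvent_inv; assumption.
Qed.

(** As G c = t, the quotient (t - G v) / (v - c) is minus the difference quotient of [G] at [c];
    hence the value [opp x] there. *)
Lemma regular_at_shifted_on y t eta (U : C -> Prop) (G : C -> E) :
  shifted_resolvent (Ci * eta)%C y t ->
  open U -> U (Ci * eta)%C -> analytic_on U G ->
  (forall l, U l -> Re l <> 0 -> G l = Rs l y) -> G (Ci * eta)%C = t ->
  regular_at t eta.
Proof.
intros Ht HU HUe HG HGe Hval; set (c := (Ci * eta)%C) in *.
destruct (has_pseries_shift G c (HG c HUe)) as [x Hx].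
set (H := fun v => if Ceq_dec v c then opp x else (/ (v - c))%C ** minus t (G v)).
exists U, H; split; [exact HU|split; [exact HUe|split]].
- intros w Hw; destruct (Ceq_dec w c) as [->|Hwc].
  + apply (has_pseries_ext (fun w => (- (1))%C **
      (if Ceq_dec w c then x else (/ (w - c))%C ** minus (G w) (G c))) _ _ 1 Rlt_0_1).
    * intros v _; unfold H; destruct (Ceq_dec v c); [|rewrite Hval]; lin_ring.
    * exact (has_pseries_scal _ _ _ Hx).
  + assert (Hd : 0 < Cmod (c - w)).
    { apply Cmod_gt_0; intros K; apply Hwc.
      replace w with (c - (c - w))%C by ring; rewrite K; ring. }
    apply (has_pseries_ext (fun v => (/ (v - c))%C ** minus t (G v)) _ _ _ Hd).
    * intros v Hv; unfold H; destruct (Ceq_dec v c) as [->|Hvc]; [lra|reflexivity].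
    * exact (has_pseries_quotient G c t w Hwc (HG w Hw)).
- intros l Hl Hl0; unfold H; destruct (Ceq_dec l c) as [->|Hlc].
  + exfalso; apply Hl0; unfold c, Re; simpl; ring.
  + rewrite HGe by assumption; apply shifted_resolvent_inv; assumption.
Qed.

(** Describes the value of an extension at [i eta] through the family alone, so that values obtained
    from different extensions can be compared and added. *)
Definition right_limit eta y t : Prop :=
  forall e, 0 < e -> exists d, 0 < d /\ forall s : R, 0 < s < d ->
    norm (minus (Rs (Ci * eta + s) y) t) < e.

Lemma Re_right eta (s : R) : Re (Ci * eta + s) = s.
Proof. unfold Re; simpl; ring. Qed.

Lemma right_limit_of_extension eta y (U : C -> Prop) (G : C -> E) :
  open U -> U (Ci * eta)%C -> analytic_on U G ->
  (forall l, U l -> Re l <> 0 -> G l = Rs l y) -> right_limit eta y (G (Ci * eta)%C).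
Proof.
intros HU HUe HG HGe e He.
destruct (taylor3_lipschitz _ _ (has_pseries_taylor3 _ _ (HG _ HUe)))
  as [L [r [HL [Hr H]]]].
destruct (open_C_ball U _ HU HUe) as [r' [Hr' HrU]].
assert (Hq : 0 < e / (L + 1)) by (apply Rdiv_lt_0_compat; lra).
exists (Rmin (Rmin r r') (e / (L + 1))).
split; [apply Rmin_pos; [apply Rmin_pos|]; assumption|]; intros s [Hs0 Hs].
assert (Hm : Cmod (RtoC s) = s) by (rewrite Cmod_R, Rabs_pos_eq; lra).
assert (H1 : s < r)
  by (eapply Rlt_le_trans; [exact Hs|eapply Rle_trans; [apply Rmin_l|apply Rmin_l]]).
assert (H2 : s < r')
  by (eapply Rlt_le_trans; [exact Hs|eapply Rle_trans; [apply Rmin_l|apply Rmin_r]]).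
assert (H3 : s < e / (L + 1)) by (eapply Rlt_le_trans; [exact Hs|apply Rmin_r]).
rewrite <- HGe.
- apply Rle_lt_trans with (L * s).
  + rewrite <- Hm at 2; apply H; rewrite Hm; exact H1.
  + apply (Rmult_lt_compat_r (L + 1)) in H3; [|lra].
    unfold Rdiv in H3; rewrite Rmult_assoc, Rinv_l in H3; lra.
- apply HrU; replace (Ci * eta + s - Ci * eta)%C with (RtoC s) by ring.
  rewrite Hm; exact H2.
- rewrite Re_right; lra.
Qed.

Lemma right_limit_common eta y t y' t' e : right_limit eta y t -> right_limit eta y' t' ->
  0 < e -> exists d, 0 < d /\ forall s : R, 0 < s < d ->
    norm (minus (Rs (Ci * eta + s) y) t) < e /\
    norm (minus (Rs (Ci * eta + s) y') t') < e.
Proof.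
intros H H' He; destruct (H e He) as [d [Hd K]], (H' e He) as [d' [Hd' K']].
exists (Rmin d d'); split; [apply Rmin_pos; assumption|]; intros s [Hs0 Hs].
split; [apply K|apply K']; split; trivial; apply Rlt_le_trans with (1 := Hs).
- apply Rmin_l.
- apply Rmin_r.
Qed.

Lemma right_limit_uniq eta y t t' : right_limit eta y t -> right_limit eta y t' -> t = t'.
Proof.
intros H H'; apply norm_minus_le0, le_epsilon; intros e He.
destruct (right_limit_common eta y t y t' (e / 2) H H') as [d [Hd K]]; [lra|].
destruct (K (d / 2)) as [K1 K2]; [lra|].
set (v := Rs _ y) in *.
replace (minus t t') with (minus (minus v t') (minus v t)) by lin_ring.
assert (T := norm_minus_le (minus v t') (minus v t)); lra.
Qed.

Lemma right_limit_plus eta y t y' t' : right_limit eta y t -> right_limit eta y' t' ->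
  right_limit eta (plus y y') (plus t t').
Proof.
intros H H' e He.
destruct (right_limit_common eta y t y' t' (e / 2) H H') as [d [Hd K]]; [lra|].
exists d; split; [exact Hd|]; intros s Hs; destruct (K s Hs) as [K1 K2].
rewrite Rs_plus by (rewrite Re_right; lra).
set (v := Rs _ y) in *; set (v' := Rs _ y') in *.
replace (minus _ _) with (plus (minus v t) (minus v' t')) by lin_ring.
assert (T := norm_triangle (minus v t) (minus v' t')).
apply Rle_lt_trans with (1 := T); lra.
Qed.

Lemma right_limit_scal eta (k : C) y t :
  right_limit eta y t -> right_limit eta (k ** y) (k ** t).
Proof.
intros H e He; assert (Hk := Cmod_ge_0 k).
destruct (H (e / (Cmod k + 1))) as [d [Hd K]]; [apply Rdiv_lt_0_compat; lra|].
exists d; split; [exact Hd|]; intros s Hs; specialize (K s Hs).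
rewrite Rs_scal by (rewrite Re_right; lra).
set (v := Rs _ y) in *.
replace (minus _ _) with (k ** minus v t) by lin_ring.
rewrite norm_cscal.
apply (Rmult_lt_compat_r (Cmod k + 1)) in K; [|lra].
unfold Rdiv in K; rewrite Rmult_assoc, Rinv_l in K by lra.
assert (Hn := norm_ge_0 (minus v t)); lra.
Qed.

Lemma right_limit_bounded eta y t : right_limit eta y t ->
  exists d, 0 < d /\ forall s : R, 0 < s < d -> norm (Rs (Ci * eta + s) y) <= norm t + 1.
Proof.
intros H; destruct (H 1 Rlt_0_1) as [d [Hd K]]; exists d; split; [exact Hd|].
intros s Hs; specialize (K s Hs).
assert (T := norm_le_minus (Rs (Ci * eta + s) y) t); lra.
Qed.

(** The resolvent identity between m and c + s, as s tends to 0. The bound on [Rs m] carries the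
    limit through, and the correction s R(m) v vanishes because v = R(c + s) y stays bounded. *)
Lemma right_limit_shifted eta y t :
  right_limit eta y t -> shifted_resolvent (Ci * eta)%C y t.
Proof.
intros H m Hm; set (c := (Ci * eta)%C); apply norm_minus_le0, le_epsilon; intros e He.
set (b := / Rabs (Re m)).
assert (Hb : 0 < b) by (apply Rinv_0_lt_compat, Rabs_pos_lt, Hm).
assert (Hmc := Cmod_ge_0 (m - c)); assert (Ht := norm_ge_0 t).
(* The total error is at most [K1] |v - t| + s [K2]; each term gets e / 2. *)
set (K1 := Cmod (m - c) * b + 1); set (K2 := b * (norm t + 1)).
assert (HK1 : 1 <= K1).
{ assert (0 <= Cmod (m - c) * b) by (apply Rmult_le_pos; lra); unfold K1; lra. }
assert (HK2 : 0 < K2) by (apply Rmult_lt_0_compat; lra).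
destruct (H (e / (2 * K1))) as [d [Hd Hlim]]; [apply Rdiv_lt_0_compat; lra|].
destruct (right_limit_bounded eta y t H) as [d' [Hd' Hbd]].
set (s := Rmin (Rmin (d / 2) (d' / 2)) (e / (2 * K2))).
assert (Hs : 0 < s).
{ apply Rmin_pos; [apply Rmin_pos; lra|apply Rdiv_lt_0_compat; lra]. }
assert (Hs1 : s <= d / 2) by (eapply Rle_trans; [apply Rmin_l|apply Rmin_l]).
assert (Hs2 : s <= d' / 2) by (eapply Rle_trans; [apply Rmin_l|apply Rmin_r]).
assert (Hs3 : s <= e / (2 * K2)) by apply Rmin_r.
specialize (Hlim s ltac:(lra)); specialize (Hbd s ltac:(lra)); fold c in Hlim, Hbd.
set (l := (c + s)%C) in *.
assert (Hl : Re l <> 0) by (unfold l, c; rewrite Re_right; lra).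
assert (Hid := resolvent_identity m l y Hm Hl).
set (v := Rs l y) in *.
replace (minus _ _) with
  (plus ((m - c) ** Rs m (minus t v)) (plus (RtoC s ** Rs m v) (minus v t))).
2:{ rewrite Rs_minus by exact Hm.
  replace (minus t (Rs m y)) with (minus t (plus (minus (Rs m y) v) v)) by lin_ring.
  rewrite <- Hid; unfold l; lin_ring. }
apply Rle_trans with (1 := norm_triangle _ _).
assert (T := norm_triangle (RtoC s ** Rs m v) (minus v t)).
rewrite norm_cscal in T |- *; rewrite Cmod_R, Rabs_pos_eq in T by lra.
assert (B1 := Rs_bound m (minus t v) Hm); assert (B2 := Rs_bound m v Hm).
unfold Rdiv in B1, B2; fold b in B1, B2; rewrite norm_minus_sym in B1.
assert (N : Cmod (m - c) * norm (Rs m (minus t v)) <= Cmod (m - c) * b * norm (minus v t)).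
{ rewrite Rmult_assoc; apply Rmult_le_compat_l; lra. }
assert (N2 : s * norm (Rs m v) <= s * K2).
{ apply Rmult_le_compat_l; [lra|]; unfold K2; rewrite Rmult_comm in B2.
  apply Rle_trans with (1 := B2), Rmult_le_compat_l; lra. }
assert (N3 : K1 * norm (minus v t) <= e / 2).
{ apply Rle_trans with (K1 * (e / (2 * K1))); [apply Rmult_le_compat_l; lra|].
  right; field; lra. }
assert (N4 : s * K2 <= e / 2).
{ apply Rle_trans with (e / (2 * K2) * K2); [apply Rmult_le_compat_r; lra|].
  right; field; lra. }
unfold K1 in N3.
eapply Rle_trans; [apply Rplus_le_compat_l; exact T|]; lra.
Qed.

(** R(c + s) (c x - z) = x - s R(c + s) x, and the limit [t] keeps R(c + s) x bounded. This makes
    the limit operator a left inverse of c - A. *)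
Lemma right_limit_A eta x z t : A x z -> right_limit eta x t ->
  right_limit eta (minus ((Ci * eta) ** x) z) x.
Proof.
intros HA H e He; assert (Ht := norm_ge_0 t).
destruct (right_limit_bounded eta x t H) as [d [Hd K]].
exists (Rmin d (e / (norm t + 1))).
split; [apply Rmin_pos; [lra|apply Rdiv_lt_0_compat; lra]|]; intros s [Hs0 Hs].
assert (Hs1 : s < d) by (apply Rlt_le_trans with (1 := Hs), Rmin_l).
assert (Hs2 : s < e / (norm t + 1)) by (apply Rlt_le_trans with (1 := Hs), Rmin_r).
specialize (K s (conj Hs0 Hs1)).
set (c := (Ci * eta)%C) in *; set (l := (c + s)%C) in *.
assert (Hl : Re l <> 0) by (unfold l, c; rewrite Re_right; lra).
apply (A_Rs l) in HA; [|exact Hl].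
replace (minus (c ** x) z) with (minus (minus (l ** x) z) (RtoC s ** x))
  by (unfold l; lin_ring).
rewrite Rs_minus, <- HA, Rs_scal by exact Hl.
replace (minus _ _) with ((- RtoC s) ** Rs l x) by lin_ring.
rewrite norm_cscal, Cmod_opp, Cmod_R, Rabs_pos_eq by lra.
apply Rle_lt_trans with (s * (norm t + 1)); [apply Rmult_le_compat_l; lra|].
apply (Rmult_lt_compat_r (norm t + 1)) in Hs2; [|lra].
unfold Rdiv in Hs2; rewrite Rmult_assoc, Rinv_l in Hs2; lra.
Qed.

(** Four substitutions of the resolvent identity into itself: R(w + u) = R - u R^2 + u^2 R^3 - u^3
    R^4 + u^4 R(w + u) R^4 with R = R(w). For |u| < r / 2 the last resolvent has norm at most 2 /
    r. *)
Lemma Rs_taylor3 y w : Re w <> 0 -> taylor3 (fun l => Rs l y) w.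
Proof.
intros Hw; assert (Hr := Rabs_pos_lt _ Hw); set (r := Rabs (Re w)) in *.
set (R1 := Rs w y); set (R2 := Rs w R1); set (R3 := Rs w R2); set (R4 := Rs w R3).
exists (opp R2), R3, (opp R4), (2 / r * norm R4), (r / 2).
split; [apply Rmult_le_pos; [apply Rdiv_le_0_compat; lra|apply norm_ge_0]|].
split; [lra|]; intros u Hu.
assert (Hre : r / 2 <= Rabs (Re (w + u))).
{ assert (T := Rabs_triang_inv (Re w) (- Re u)).
  replace (Re w - - Re u) with (Re (w + u)) in T by (unfold Re; simpl; ring).
  assert (T' := re_le_Cmod u); rewrite Rabs_Ropp in T; fold r in T; lra. }
assert (Hwu : Re (w + u) <> 0).
{ intros K; rewrite K, Rabs_R0 in Hre; lra. }
assert (Hid : forall x, Rs (w + u)%C x = minus (Rs w x) (u ** Rs (w + u)%C (Rs w x))).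
{ intros x; assert (T := resolvent_identity (w + u)%C w x Hwu Hw).
  transitivity (plus (Rs w x) (minus (Rs (w + u)%C x) (Rs w x))); [lin_ring|].
  rewrite <- T; lin_ring. }
rewrite (Hid y); fold R1; rewrite (Hid R1); fold R2.
rewrite (Hid R2); fold R3; rewrite (Hid R3); fold R4.
replace (minus _ _) with ((u * u * u * u) ** Rs (w + u)%C R4) by lin_ring.
rewrite norm_cscal, !Cmod_mult.
replace (Cmod u * Cmod u * Cmod u * Cmod u) with (Cmod u ^ 4) by ring.
rewrite (Rmult_comm (_ * norm R4)).
apply Rmult_le_compat_l; [apply pow_le, Cmod_ge_0|].
apply Rle_trans with (1 := Rs_bound _ _ Hwu); unfold Rdiv at 1.
rewrite Rmult_comm; apply Rmult_le_compat_r; [apply norm_ge_0|].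
replace (2 / r) with (/ (r / 2)) by (field; lra).
apply Rinv_le_contravar; lra.
Qed.

Lemma C_imag w : Re w = 0 -> w = (Ci * Im w)%C.
Proof.
destruct w as [a b]; unfold Re; simpl; intros ->.
unfold Cmult, RtoC; simpl; f_equal; ring.
Qed.

(* The multiplier [(w - c - i d)(w - c + i d)] with [c = i xi] is [O(|Re w|)] on the
   boundary of the square of centre [c] and half-side [d], which compensates
   the bound [norm y / |Re w|] of the resolvent. *)
Lemma right_limit_norm xi (d : R) y t : 0 < d ->
  (forall eta, Rabs (eta - xi) <= 2 * d -> regular_at y eta) ->
  right_limit xi y t -> norm t <= 4 / d * norm y.
Proof.
intros Hd Hreg Ht.
assert (Hlim : forall eta, exists v, Rabs (eta - xi) <= 2 * d -> right_limit eta y v).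
{ intros eta; destruct (classic (Rabs (eta - xi) <= 2 * d)) as [H|H].
  - destruct (Hreg eta H) as [U [G [HU [HUe [HG HGe]]]]].
    exists (G (Ci * eta)%C); intros _; exact (right_limit_of_extension _ _ U G HU HUe HG HGe).
  - exists t; intros K; contradiction. }
destruct (choice _ Hlim) as [v Hv].
(* One function on the whole square: by uniqueness of right limits every local extension agrees with
   it, on the axis as well. *)
set (G := fun w : C => if Req_dec_T (Re w) 0 then v (Im w) else Rs w y).
set (c := (Ci * xi)%C).
assert (Hc : Re c = 0 /\ Im c = xi) by (unfold c, Re, Im; simpl; split; ring).
destruct Hc as [Hc1 Hc2].
set (p := (c + Ci * d)%C); set (q := (c - Ci * d)%C).
set (h := fun w : C => (w - p) ** ((w - q) ** G w)).
assert (Hy := norm_ge_0 y).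
assert (HGt : G c = t).
{ unfold G; destruct (Req_dec_T (Re c) 0) as [_|K]; [|contradiction].
  rewrite Hc2; apply (right_limit_uniq xi y); [apply Hv|exact Ht].
  replace (xi - xi) with 0 by ring; rewrite Rabs_R0; lra. }
assert (Hhc : norm (h c) = d ^ 2 * norm t).
{ unfold h; rewrite HGt, !norm_cscal.
  replace (c - p)%C with (- (Ci * d))%C by (unfold p; ring).
  replace (c - q)%C with (Ci * d)%C by (unfold q; ring).
  rewrite Cmod_opp, Cmod_mult, Cmod_Ci, Cmod_R, Rabs_pos_eq by lra; ring. }
assert (Hmax : norm (h c) <= 4 * d * norm y).
{ apply (maximum_principle h c d); [exact Hd| |].
  - intros z [Hz1 Hz2]; rewrite Hc2 in Hz2.
    unfold h; apply taylor3_mul, taylor3_mul.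
    destruct (Req_dec (Re z) 0) as [Hz0|Hz0].
    + assert (Hzd : Rabs (Im z - xi) <= 2 * d) by (apply Rabs_le; lra).
      destruct (Hreg (Im z) Hzd) as [U [H [HU [HUe [HH HHe]]]]].
      rewrite <- (C_imag z Hz0) in HUe.
      destruct (open_C_ball U z HU HUe) as [r [Hr HrU]].
      (* The radius [d] around a point of the square keeps imaginary parts within 2 d of [xi], where
         [v] is a right limit. *)
      apply (taylor3_ext H G z (Rmin r d)); [now apply Rmin_pos| |].
      * intros w Hw.
        assert (HUw : U w) by (apply HrU, Rlt_le_trans with (1 := Hw), Rmin_l).
        unfold G; destruct (Req_dec_T (Re w) 0) as [Hw0|Hw0]; [|now apply HHe].
        transitivity (H (Ci * Im w)%C); [exact (f_equal H (C_imag w Hw0))|].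
        assert (HUw' : U (Ci * Im w)%C) by (rewrite <- (C_imag w Hw0); exact HUw).
        apply (right_limit_uniq (Im w) y).
        -- exact (right_limit_of_extension _ _ U H HU HUw' HH HHe).
        -- apply Hv, Rabs_le.
           assert (T := Rle_trans _ _ _ (Rmax_r _ _) (Rmax_Cmod (w - z)%C)).
           change (Rabs (Im w - Im z) <= Cmod (w - z)) in T.
           assert (Hwd : Cmod (w - z) < d) by (apply Rlt_le_trans with (1 := Hw), Rmin_r).
           apply Rle_lt_trans with (2 := Hwd), Rabs_def2 in T; lra.
      * exact (has_pseries_taylor3 _ _ (HH z HUe)).
    + assert (Hzr := Rabs_pos_lt _ Hz0).
      apply (taylor3_ext (fun l => Rs l y) G z (Rabs (Re z))); [exact Hzr| |].
      * intros w Hw; unfold G; destruct (Req_dec_T (Re w) 0) as [Hw0|Hw0]; [|reflexivity].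
        exfalso; assert (T := re_le_Cmod (w - z)%C).
        replace (Re (w - z)) with (- Re z) in T
          by (transitivity (Re w - Re z); [lra|reflexivity]).
        rewrite Rabs_Ropp in T; lra.
      * apply Rs_taylor3, Hz0.
  - intros z [Hz1 Hz2] Hb; rewrite Hc1, Hc2 in *.
    set (a := Re z) in *; set (b := Im z - xi) in *.
    assert (Hb1 : - d <= b <= d) by (unfold b; lra).
    assert (Hp : Cmod (z - p) <= Rabs a + (d - b)).
    { apply Rle_trans with (1 := Cmod_le_abs _); apply Req_le; f_equal.
      - f_equal; unfold p, c, a, Re; simpl; ring.
      - rewrite <- (Rabs_pos_eq (d - b)), <- Rabs_Ropp by lra; f_equal.
        unfold p, c, b, Im; simpl; ring. }
    assert (Hq : Cmod (z - q) <= Rabs a + (d + b)).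
    { apply Rle_trans with (1 := Cmod_le_abs _); apply Req_le; f_equal.
      - f_equal; unfold q, c, a, Re; simpl; ring.
      - rewrite <- (Rabs_pos_eq (d + b)) by lra; f_equal.
        unfold q, c, b, Im; simpl; ring. }
    assert (Ha : Rabs a <= d) by (apply Rabs_le; lra).
    assert (Ha0 := Rabs_pos a); set (a' := Rabs a) in *.
    (* The product is a'^2 + 2 d a' + (d^2 - b^2). On the vertical sides a' = d, so d^2 - b^2 <= d
       a'; on the horizontal ones d^2 - b^2 = 0. *)
    assert (Hpq : Cmod (z - p) * Cmod (z - q) <= 4 * d * a').
    { apply Rle_trans with ((a' + (d - b)) * (a' + (d + b))).
      - apply Rmult_le_compat; try apply Cmod_ge_0; assumption.
      - replace ((a' + (d - b)) * (a' + (d + b))) with (a' * a' + 2 * d * a' + (d * d - b * b))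
          by ring.
        assert (Haa : a' * a' <= d * a') by (apply Rmult_le_compat_r; lra).
        assert (Hbb := Rle_0_sqr b); unfold Rsqr in Hbb.
        destruct Hb as [Hb|Hb].
        + replace (a - 0) with a in Hb by ring; fold a' in Hb; rewrite Hb in *; lra.
        + assert (Hbd : b * b = d * d).
          { rewrite <- Hb; exact (Rsqr_abs b). }
          assert (0 <= d * a') by (apply Rmult_le_pos; lra); lra. }
    assert (HG : a' * norm (G z) <= norm y).
    { unfold G; fold a; destruct (Req_dec_T a 0) as [K|K].
      - unfold a'; rewrite K, Rabs_R0, Rmult_0_l; exact Hy.
      - assert (T := Rs_bound z y K); fold a a' in T.
        assert (Ha1 : 0 < a') by (apply Rabs_pos_lt, K).
        apply (Rmult_le_compat_l a') in T; [|lra].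
        apply Rle_trans with (1 := T), Req_le; field; lra. }
    unfold h; rewrite !norm_cscal, <- Rmult_assoc.
    apply Rle_trans with (4 * d * a' * norm (G z)).
    + apply Rmult_le_compat_r; [apply norm_ge_0|exact Hpq].
    + rewrite Rmult_assoc; apply Rmult_le_compat_l; lra. }
apply Rmult_le_reg_l with (d ^ 2); [apply pow_lt, Hd|].
rewrite <- Hhc; apply Rle_trans with (1 := Hmax), Req_le; field; lra.
Qed.

(** The right inverse property is membership of the pair (T y, c T y - y) in [A], which [A_Rs] tests
    at a single point off the axis: the shifted identity at m = 1 is exactly that test. *)
Lemma resolvent_set_of_shifted (P : E -> Prop) c (T : E -> E) (M : R) :
  (forall x y, P x -> P y -> P (plus x y)) ->
  (forall (k : C) x, P x -> P (k ** x)) ->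
  (forall y, P y -> P (T y)) ->
  (forall x y, P x -> P y -> T (plus x y) = plus (T x) (T y)) ->
  (forall (k : C) x, P x -> T (k ** x) = k ** T x) ->
  (forall y, P y -> norm (T y) <= M * norm y) ->
  (forall y, P y -> shifted_resolvent c y (T y)) ->
  (forall x z, P x -> P z -> A x z -> T (minus (c ** x) z) = x) ->
  resolvent_set P (part A P) c.
Proof.
intros HPp HPs HT Tp Ts TM Tc TA; exists T; split; [exact HT|].
split; [exact Tp|split; [exact Ts|split; [now exists M|split]]].
- intros x z [Hx [Hz HA]]; now apply TA.
- intros y Hy; exists (minus (c ** T y) y); split; [|lin_ring].
  split; [now apply HT|split].
  + replace (minus (c ** T y) y) with (plus (c ** T y) ((- (1))%C ** y)) by lin_ring.
    apply HPp; apply HPs; auto.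
  + assert (H1 : Re (RtoC 1) <> 0) by (simpl; lra).
    apply (A_Rs (RtoC 1)); [exact H1|].
    assert (K := Tc y Hy (RtoC 1) H1).
    replace (minus _ _) with (plus ((RtoC 1 - c) ** T y) y) by lin_ring.
    rewrite Rs_plus, Rs_scal by exact H1.
    transitivity (plus (minus (T y) (Rs (RtoC 1) y)) (Rs (RtoC 1) y)); [lin_ring|].
    exact (f_equal (fun v => plus v (Rs (RtoC 1) y)) (eq_sym K)).
Qed.

(** Off the axis [Rs c] itself is the inverse. On the axis it is the right limit at [xi], and a gap
    of [Lambda] around [xi], the same for all [y], gives the uniform bound. *)
Lemma resolvent_set_part (Lambda : R -> Prop) c : closed Lambda ->
  ~ (exists xi, Lambda xi /\ c = (Ci * xi)%C) ->
  resolvent_set (fun y => forall eta, ~ Lambda eta -> regular_at y eta)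
    (part A (fun y => forall eta, ~ Lambda eta -> regular_at y eta)) c.
Proof.
intros HL Hc.
set (P := fun y => forall eta, ~ Lambda eta -> regular_at y eta).
assert (HPp : forall x y, P x -> P y -> P (plus x y)).
{ intros x y Hx Hy eta He; apply regular_at_plus; auto. }
assert (HPs : forall (k : C) x, P x -> P (k ** x)).
{ intros k x Hx eta He; apply regular_at_scal; auto. }
destruct (Req_dec (Re c) 0) as [Hc0|Hc0].
2:{ assert (Hsh : forall y, shifted_resolvent c y (Rs c y)).
  { intros y m Hm; rewrite Rs_comm by assumption.
    transitivity (opp ((c - m) ** Rs c (Rs m y))); [lin_ring|].
    rewrite Rs_comm, resolvent_identity by assumption; lin_ring. }
  apply resolvent_set_of_shifted with (T := Rs c) (M := / Rabs (Re c));
    try assumption; try (intros; auto; fail).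
  - intros y Hy eta He; apply (regular_at_shifted_off c y); [|apply Hsh|apply Hy, He].
    intros K; apply Hc0; rewrite <- K; unfold Re; simpl; ring.
  - intros y _; rewrite Rmult_comm; exact (Rs_bound c y Hc0).
  - intros x z _ _ HA; symmetry; exact (proj1 (A_Rs c x z Hc0) HA). }
set (xi := Im c); assert (Hcx := C_imag c Hc0); fold xi in Hcx.
assert (Hxi : ~ Lambda xi) by (intros K; apply Hc; now exists xi).
assert (Hball : exists r, 0 < r /\ forall eta, Rabs (eta - xi) < r -> ~ Lambda eta).
{ apply NNPP; intros Hno; apply Hxi, HL; intros [e He]; apply Hno.
  exists e; split; [apply cond_pos|exact He]. }
destruct Hball as [r [Hr HrL]].
assert (Hlim : forall y, exists t, P y -> right_limit xi y t).
{ intros y; destruct (classic (P y)) as [Hy|Hy]; [|exists y; intros K; contradiction].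
  destruct (Hy xi Hxi) as [U [G [HU [HUe [HG HGe]]]]].
  exists (G (Ci * xi)%C); intros _; exact (right_limit_of_extension _ _ U G HU HUe HG HGe). }
destruct (choice _ Hlim) as [T HT].
assert (Huniq : forall y t, P y -> right_limit xi y t -> T y = t).
{ intros y t Hy Ht; exact (right_limit_uniq _ _ _ _ (HT y Hy) Ht). }
(* Half-side r / 3: the norm estimate needs regularity up to distance 2 r / 3, inside the gap of
   radius [r]. *)
apply resolvent_set_of_shifted with (T := T) (M := 4 / (r / 3)); try assumption.
- intros y Hy eta He; assert (Hs := right_limit_shifted _ _ _ (HT y Hy)).
  destruct (Req_dec eta xi) as [->|Hne].
  + destruct (Hy xi Hxi) as [U [G [HU [HUe [HG HGe]]]]].
    apply (regular_at_shifted_on y (T y) xi U G Hs HU HUe HG HGe).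
    symmetry; apply Huniq; [exact Hy|].
    exact (right_limit_of_extension _ _ U G HU HUe HG HGe).
  + apply (regular_at_shifted_off (Ci * xi)%C y); [|exact Hs|apply Hy, He].
    intros K; apply Hne; apply (f_equal Im) in K; unfold Im in K; simpl in K; lra.
- intros x y Hx Hy; apply Huniq; [now apply HPp|apply right_limit_plus; auto].
- intros k x Hx; apply Huniq; [now apply HPs|apply right_limit_scal; auto].
- intros y Hy; apply (right_limit_norm xi); [lra| |now apply HT].
  intros eta He; apply Hy, HrL; lra.
- intros y Hy; rewrite Hcx; apply right_limit_shifted; auto.
- intros x z Hx Hz HA; apply Huniq.
  + intros eta He; apply regular_at_minus; [apply regular_at_scal|]; auto.
  + rewrite Hcx; apply (right_limit_A xi x z (T x)); auto.
Qed.

End PseudoResolvent.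

(** * The derivation on [BC(R, X)] and its quotient *)

(** The exponential of l t for real t, in real coordinates so that real calculus applies to each
    part. *)
Definition cexp (l : C) (t : R) : C :=
  (exp (Re l * t) * cos (Im l * t), exp (Re l * t) * sin (Im l * t)).

Lemma Cmod_cexp l t : Cmod (cexp l t) = exp (Re l * t).
Proof.
unfold Cmod, cexp; simpl.
replace (_ + _) with ((exp (Re l * t))² * ((sin (Im l * t))² + (cos (Im l * t))²))
  by (unfold Rsqr; ring).
rewrite sin2_cos2, Rmult_1_r; apply sqrt_Rsqr, Rlt_le, exp_pos.
Qed.

Lemma cexp_opp l t : (cexp l t * cexp (- l) t)%C = RtoC 1.
Proof.
unfold cexp, Cmult, RtoC.
change (Re (- l)) with (- Re l); change (Im (- l)) with (- Im l); simpl.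
replace (- Re l * t) with (- (Re l * t)) by ring.
replace (- Im l * t) with (- (Im l * t)) by ring.
rewrite cos_neg, sin_neg.
assert (He : exp (Re l * t) * exp (- (Re l * t)) = 1)
  by (rewrite <- exp_plus, <- exp_0; f_equal; ring).
assert (Hs := sin2_cos2 (Im l * t)); unfold Rsqr in Hs.
set (c := cos (Im l * t)) in *; set (s := sin (Im l * t)) in *.
set (e := exp (Re l * t)) in *; set (e' := exp (- (Re l * t))) in *.
f_equal.
- replace (_ - _) with ((e * e') * (s * s + c * c)) by ring; rewrite He, Hs; ring.
- ring.
Qed.

(** From exp x >= 1 + x at x = K / e. It gives an explicit point beyond which an exponential tail is
    small. *)
Lemma exp_decay (K e : R) : 0 <= K -> 0 < e -> K * exp (- (K / e)) <= e.
Proof.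
intros HK He; assert (Hx : 0 <= K / e) by (apply Rdiv_le_0_compat; lra).
assert (H := exp_ineq1_le (K / e)); rewrite exp_Ropp.
apply Rmult_le_reg_r with (exp (K / e)); [apply exp_pos|].
rewrite Rmult_assoc, Rinv_l by (apply Rgt_not_eq, exp_pos).
apply Rle_trans with (e * (1 + K / e)).
- replace (e * (1 + K / e)) with (e + K) by (field; lra); lra.
- apply Rmult_le_compat_l; lra.
Qed.

Lemma is_derive_scal_fct (V : NormedModule R_AbsRing) (f : R -> R) (u : R -> V)
    (t df : R) (du : V) :
  is_derive f t df -> is_derive u t du ->
  is_derive (fun s => scal (f s) (u s)) t (plus (scal df (u t)) (scal (f t) du)).
Proof.
intros Hf Hu; unfold is_derive in *.
eapply filterdiff_ext_lin.
- exact (@filterdiff_scal_fct R_AbsRing (AbsRing_NormedModule R_AbsRing) V t f u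
    (fun y => scal y df) (fun y => scal y du) Rmult_comm Hf Hu).
- intros s; simpl; rewrite scal_distr_l, !scal_assoc; f_equal.
  f_equal; apply Rmult_comm.
Qed.

(** * Vector-valued equations u' = l u - g: uniqueness and the Laplace integral *)

Section Realified.
Context {X : CNormedModule}
  (cX : CompleteSpace.mixin_of (NormedModule.UniformSpace C_AbsRing X)).
Implicit Types (u v : R -> X) (l : C) (s t : R).

(** Completeness concerns only the uniform structure, which [realify] keeps, so the same mixin
    serves the real space while [X] remains a plain complex normed module. *)
Definition realify_complete : CompleteNormedModule R_AbsRing :=
  CompleteNormedModule.Pack R_AbsRing X
    (CompleteNormedModule.Class R_AbsRing X
       (NormedModule.class R_AbsRing (realify X)) cX) X.

Lemma cexp_scalE l s (x : X) : cexp l s ** x =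
  plus (@scal R_AbsRing (realify X) (exp (Re l * s) * cos (Im l * s)) x)
    (@scal R_AbsRing (realify X) (exp (Re l * s) * sin (Im l * s)) (Ci ** x)).
Proof.
set (a := exp _ * _); set (b := exp _ * _).
change (cexp l s ** x = plus (RtoC a ** x) (RtoC b ** (Ci ** x))).
lin_coefs; unfold cexp; fold a b; unfold Cmult, Cplus, RtoC; simpl; f_equal; ring.
Qed.

Lemma is_derive_cscal (k : C) u t (x : X) : is_derive (V := realify X) u t x ->
  is_derive (V := realify X) (fun s => k ** u s) t (k ** x).
Proof.
intros H; unfold is_derive in *.
assert (HL : is_linear (K := R_AbsRing) (U := realify X) (V := realify X)
  (fun y : X => k ** y)).
{ split.
  - intros y z; exact (@scal_distr_l C_AbsRing X k y z).
  - intros r y; change (k ** (RtoC r ** y) = RtoC r ** (k ** y)); lin_ring.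
  - assert (Hk := Cmod_ge_0 k); exists (Cmod k + 1); split; [lra|]; intros y.
    change (norm (k ** y) <= (Cmod k + 1) * norm y).
    rewrite norm_cscal; apply Rmult_le_compat_r; [apply norm_ge_0|lra]. }
eapply filterdiff_ext_lin.
- exact (@filterdiff_comp' R_AbsRing (AbsRing_NormedModule R_AbsRing) (realify X)
    (realify X) u (fun y : X => k ** y) t _ _ H
    (filterdiff_linear (K := R_AbsRing) (U := realify X) (V := realify X) _ HL)).
- intros s; change (k ** (RtoC s ** x) = RtoC s ** (k ** x)); lin_ring.
Qed.

Lemma is_derive_cexp_scal l u t (x : X) : is_derive (V := realify X) u t x ->
  is_derive (V := realify X) (fun s => cexp l s ** u s) t
    (cexp l t ** plus (l ** u t) x).
Proof.
intros H.
apply is_derive_ext with (1 := fun s => eq_sym (cexp_scalE l s (u s))).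
set (a := fun s => exp (Re l * s) * cos (Im l * s)).
set (b := fun s => exp (Re l * s) * sin (Im l * s)).
assert (Ha : is_derive a t (Re l * a t - Im l * b t)).
{ unfold a, b; auto_derive; [trivial|ring]. }
assert (Hb : is_derive b t (Im l * a t + Re l * b t)).
{ unfold a, b; auto_derive; [trivial|ring]. }
assert (K := is_derive_plus (V := realify X) _ _ _ _ _
  (is_derive_scal_fct (realify X) a u t _ _ Ha H)
  (is_derive_scal_fct (realify X) b _ t _ _ Hb (is_derive_cscal Ci u t x H))).
replace (cexp l t ** plus (l ** u t) x) with
  (plus (plus (RtoC (Re l * a t - Im l * b t) ** u t) (RtoC (a t) ** x))
    (plus (RtoC (Im l * a t + Re l * b t) ** (Ci ** u t)) (RtoC (b t) ** (Ci ** x))));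
  [exact K|].
lin_coefs; unfold cexp; fold (a t) (b t); destruct l as [p q]; unfold Cmult, Cplus, RtoC; simpl; f_equal; ring.
Qed.

Lemma continuous_cexp_scal l u t : continuous u t ->
  continuous (fun s => cexp l s ** u s) t.
Proof.
intros H.
apply continuous_ext with (1 := fun s => eq_sym (cexp_scalE l s (u s))).
assert (Hc : forall f : R -> R, ex_derive f t -> continuous f t)
  by (intros f Hf; exact (ex_derive_continuous f t Hf)).
apply (continuous_plus (K := R_AbsRing) (V := realify X)).
- apply (continuous_scal (K := R_AbsRing) (V := realify X)); [|exact H].
  apply Hc; auto_derive; trivial.
- apply (continuous_scal (K := R_AbsRing) (V := realify X)).
  + apply Hc; auto_derive; trivial.
  + exact (continuous_scal_r (Ci : C_AbsRing) u t H).
Qed.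

Lemma is_derive_zero_const u : (forall t, is_derive (V := realify X) u t zero) ->
  forall s t, u s = u t.
Proof.
intros H s t.
assert (H1 : is_RInt (V := realify_complete) (fun _ => zero) s t (minus (u t) (u s))).
{ apply (is_RInt_derive (V := realify_complete) u (fun _ => zero)).
  - intros x _; exact (H x).
  - intros x _; apply continuous_const. }
assert (H2 := is_RInt_const (V := realify_complete) s t zero).
assert (H3 := is_RInt_unique (V := realify_complete) _ _ _ _ H1).
rewrite (is_RInt_unique (V := realify_complete) _ _ _ _ H2) in H3.
apply norm_minus_le0.
change (scal (RtoC (t - s) : C_AbsRing) (zero : X) = minus (u t) (u s)) in H3.
assert (H4 : minus (u s) (u t) = zero).
{ transitivity (opp (minus (u t) (u s))); [lin_ring|].
  transitivity (opp (scal (RtoC (t - s) : C_AbsRing) (zero : X))); [|lin_ring].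
  exact (f_equal (fun v : X => opp v) (eq_sym H3)). }
apply Req_le, (eq_trans (f_equal norm H4)); exact (@norm_zero C_AbsRing X).
Qed.

(** The function w(s) = e^(-l s) u(s) is constant, yet tends to 0 in one direction of time. *)
Lemma bounded_eigenfunction u l (M : R) : Re l <> 0 ->
  (forall t, is_derive (V := realify X) u t (l ** u t)) ->
  (forall t, norm (u t) <= M) -> forall t, u t = zero.
Proof.
intros Hl Hu HM t.
assert (HM0 : 0 <= M) by (apply Rle_trans with (1 := norm_ge_0 (u t)), HM).
set (w := fun s => cexp (- l) s ** u s).
assert (Hw : forall s r, w s = w r).
{ apply is_derive_zero_const; intros s.
  assert (K := is_derive_cexp_scal (- l)%C u s _ (Hu s)).
  assert (Hz : cexp (- l) s ** plus ((- l) ** u s) (l ** u s) = (zero : X)) by lin_ring.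
  exact (eq_rect _ (fun v : X => is_derive (V := realify X) w s v) K _ Hz). }
assert (Hnw : forall s, norm (w s) <= exp (- (Re l * s)) * M).
{ intros s; unfold w; rewrite norm_cscal, Cmod_cexp.
  replace (Re (- l) * s) with (- (Re l * s))
    by (change (Re (- l)) with (- Re l); ring).
  apply Rmult_le_compat_l; [apply Rlt_le, exp_pos|apply HM]. }
apply (@norm_eq_zero C_AbsRing X), Rle_antisym; [|apply norm_ge_0].
apply le_epsilon; intros e He; rewrite Rplus_0_l.
set (K := exp (Re l * t) * M).
assert (HK : 0 <= K) by (apply Rmult_le_pos; [apply Rlt_le, exp_pos|exact HM0]).
apply Rle_trans with (2 := exp_decay K e HK He).
replace (u t) with (cexp l t ** w t)
  by (unfold w; rewrite cscal_assoc, cexp_opp; apply cscal_one).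
(* At this point the exponent is -K / e whatever the sign of Re l. *)
rewrite (Hw t (K / e / Re l)), norm_cscal, Cmod_cexp.
apply Rle_trans with (exp (Re l * t) * (exp (- (Re l * (K / e / Re l))) * M)).
- apply Rmult_le_compat_l; [apply Rlt_le, exp_pos|apply Hnw].
- replace (Re l * (K / e / Re l)) with (K / e) by (field; lra).
  apply Req_le; unfold K at 2; ring.
Qed.

(** The solution is e^(l t) times the integral of e^(-l s) g(s) over s >= t, written as c - P(t)
    with P the integral from 0 and c its limit at infinity. *)
Lemma laplace_solution (g : R -> X) l (M : R) : 0 < Re l ->
  (forall t, continuous g t) -> (forall t, norm (g t) <= M) ->
  exists f : R -> X,
    (forall t, is_derive (V := realify X) f t (minus (l ** f t) (g t))) /\
    forall t, norm (f t) <= M / Re l.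
Proof.
intros Hl Hg HM; set (a := Re l) in *.
assert (HM0 : 0 <= M) by (apply Rle_trans with (1 := norm_ge_0 (g 0)), HM).
set (k := fun s => cexp (- l) s ** g s).
assert (Hk : forall s, continuous k s)
  by (intros s; apply continuous_cexp_scal, Hg).
set (P := fun t => RInt (V := realify_complete) k 0 t : X).
assert (HP : forall t, is_derive (V := realify X) P t (k t)).
{ intros t; apply (is_derive_RInt (V := realify_complete) k P 0 t); [|apply Hk].
  exists (mkposreal 1 Rlt_0_1); intros s _.
  apply (RInt_correct (V := realify_complete)), (ex_RInt_continuous (V := realify_complete)).
  intros r _; apply Hk. }
(* The integral of M e^(-a r) over r >= s, a bound for the tail of [k]. *)
set (q := fun s => M / a * exp (- (a * s))).
assert (Hq : forall s, 0 <= q s).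
{ intros s; apply Rmult_le_pos; [apply Rdiv_le_0_compat; lra|apply Rlt_le, exp_pos]. }
assert (Hinc : forall s t, s <= t -> norm (minus (P t) (P s)) <= q s).
{ intros s t Hst; apply Rle_trans with (q s - q t); [|specialize (Hq t); lra].
  apply (norm_RInt_le (V := realify_complete) k (fun r => M * exp (- (a * r))) s t
    (minus (P t) (P s)) (q s - q t) Hst).
  - intros r _; change (norm (k r) <= M * exp (- (a * r))).
    unfold k; rewrite norm_cscal, Cmod_cexp.
    replace (Re (- l) * r) with (- (a * r))
      by (change (Re (- l)) with (- a); ring).
    rewrite Rmult_comm; apply Rmult_le_compat_r; [apply Rlt_le, exp_pos|apply HM].
  - apply (is_RInt_derive (V := realify_complete) P k); intros r _; [exact (HP r)|apply Hk].
  - replace (q s - q t) with (minus (- q t) (- q s)) by (unfold minus, plus, opp; simpl; ring).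
    apply (is_RInt_derive (fun r => - q r)).
    + intros r _; unfold q; auto_derive; [trivial|field; lra].
    + intros r _; apply (ex_derive_continuous (V := R_NormedModule)); auto_derive; trivial. }
assert (Hlim : exists c : X, forall s, norm (minus c (P s)) <= q s).
{ set (Fl := filtermap P (Rbar_locally p_infty)).
  assert (HFl : ProperFilter Fl)
    by (apply filtermap_proper_filter, Rbar_locally_filter).
  assert (Hcauchy : cauchy (T := realify_complete) Fl).
  { intros e.
    assert (Hqs : exists T, q T < e).
    { exists (M / a / (e / 2) / a); unfold q.
      assert (He : 0 < e / 2) by (apply Rdiv_lt_0_compat; [apply cond_pos|lra]).
      assert (HMa : 0 <= M / a) by (apply Rdiv_le_0_compat; lra).
      assert (D := exp_decay (M / a) (e / 2) HMa He).
      replace (a * (M / a / (e / 2) / a)) with (M / a / (e / 2)) by (field; lra).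
      apply Rle_lt_trans with (1 := D); lra. }
    destruct Hqs as [T HT]; exists (P T), T; intros t Ht.
    apply (@norm_compat1 C_AbsRing X).
    apply Rle_lt_trans with (q T); [apply Hinc; lra|exact HT]. }
  set (y := lim (T := realify_complete) Fl : X).
  exists y; intros s; apply le_epsilon; intros e He.
  assert (Hf := @norm_factor_gt_0 C_AbsRing X).
  assert (He' : 0 < e / norm_factor (V := X)) by (apply Rdiv_lt_0_compat; assumption).
  destruct (complete_cauchy (T := realify_complete) Fl HFl Hcauchy (mkposreal _ He')) as [T HT].
  set (t := Rmax s (T + 1)).
  assert (Hts : s <= t) by apply Rmax_l.
  assert (HtT : T < t) by (apply Rlt_le_trans with (T + 1); [lra|apply Rmax_r]).
  assert (N := @norm_compat2 C_AbsRing X _ _ _ (HT t HtT)); simpl in N.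
  replace (norm_factor * (e / norm_factor)) with e in N by (field; lra).
  change (norm (minus (P t) y) < e) in N.
  assert (N' := Hinc s t Hts).
  replace (minus y (P s)) with (minus (minus (P t) (P s)) (minus (P t) y))
    by lin_ring.
  assert (T1 := norm_minus_le (minus (P t) (P s)) (minus (P t) y)); lra. }
destruct Hlim as [c Hc].
exists (fun t => cexp l t ** minus c (P t)); split.
- intros t.
  assert (Hd : is_derive (V := realify X) (fun s => minus c (P s)) t (opp (k t))).
  { replace (opp (k t)) with (minus (zero : X) (k t)) by lin_ring.
    apply (is_derive_minus (V := realify X)); [|exact (HP t)].
    apply (is_derive_const (V := realify X)). }
  assert (K := is_derive_cexp_scal l _ t _ Hd).
  replace (minus _ _) with (cexp l t ** plus (l ** minus c (P t)) (opp (k t)));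
    [exact K|].
  transitivity (minus (l ** (cexp l t ** minus c (P t)))
    ((cexp l t * cexp (- l) t)%C ** g t)); [unfold k; lin_ring|].
  rewrite cexp_opp; lin_ring.
- intros t; rewrite norm_cscal, Cmod_cexp; fold a.
  apply Rle_trans with (exp (a * t) * q t).
  + apply Rmult_le_compat_l; [apply Rlt_le, exp_pos|apply Hc].
  + unfold q; apply Req_le; rewrite exp_Ropp; field.
    split; [lra|apply Rgt_not_eq, exp_pos].
Qed.

End Realified.

(** * The resolvent of the derivation on bounded continuous functions *)

Section ResolventBC.
Context (X : CNormedModule)
  (cX : CompleteSpace.mixin_of (NormedModule.UniformSpace C_AbsRing X)).
Implicit Types (f g z : BC X) (l : C).

Lemma D_op_plus f g z w : D_op X f z -> D_op X g w -> D_op X (plus f g) (plus z w).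
Proof.
intros Hf Hg t; exact (is_derive_plus (V := realify X) _ _ _ _ _ (Hf t) (Hg t)).
Qed.

Lemma D_op_scal (k : C) f z : D_op X f z -> D_op X (k ** f) (k ** z).
Proof. intros Hf t; exact (is_derive_cscal k _ _ _ (Hf t)). Qed.

Lemma D_op_inj l f z g w : Re l <> 0 -> D_op X f z -> D_op X g w ->
  minus (l ** f) z = minus (l ** g) w -> f = g.
Proof.
intros Hl Hf Hg H.
assert (HD := D_op_plus _ _ _ _ Hf (D_op_scal (- (1))%C _ _ Hg)).
set (h := plus f ((- (1))%C ** g)) in HD.
assert (Hh : forall t, bc_fun h t = zero).
{ destruct (bc_bdd X h) as [M HM].
  apply (bounded_eigenfunction cX (bc_fun h) l M Hl); [|exact HM].
  intros t; assert (K := HD t).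
  assert (Hz : bc_fun (plus z ((- (1))%C ** w)) t = l ** bc_fun h t).
  { assert (Ht := f_equal (fun v : BC X => bc_fun v t) H).
    change (minus (l ** bc_fun f t) (bc_fun z t) =
      minus (l ** bc_fun g t) (bc_fun w t)) in Ht.
    change (plus (bc_fun z t) ((- (1))%C ** bc_fun w t) =
      l ** (plus (bc_fun f t) ((- (1))%C ** bc_fun g t))).
    transitivity (minus (plus (l ** bc_fun f t) ((- (1))%C ** bc_fun w t))
      (minus (l ** bc_fun f t) (bc_fun z t))); [lin_ring|].
    rewrite Ht; lin_ring. }
  exact (eq_rect _ (fun v : X => is_derive (V := realify X) (bc_fun h) t v) K _ Hz). }
apply bcfun_ext; intros t; specialize (Hh t).
change (plus (bc_fun f t) ((- (1))%C ** bc_fun g t) = zero) in Hh.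
transitivity (plus (plus (bc_fun f t) ((- (1))%C ** bc_fun g t)) (bc_fun g t));
  [lin_ring|].
rewrite Hh; apply plus_zero_l.
Qed.

Lemma norm_BC_ge f t : norm (bc_fun f t) <= norm f.
Proof. exact (norm_le_sup X f t). Qed.

Lemma norm_BC_le f (M : R) : (forall t, norm (bc_fun f t) <= M) -> norm f <= M.
Proof. exact (sup_norm_le X f M). Qed.

Lemma resolvent_ex_pos l g : 0 < Re l ->
  exists f, D_op X f (minus (l ** f) g) /\ norm f <= norm g / Re l.
Proof.
intros Hl; destruct (laplace_solution cX (bc_fun g) l (norm g) Hl (bc_cont X g)
  (norm_BC_ge g)) as [f [Hf Hn]].
assert (Hc : forall t, continuous f t).
{ intros t; apply (ex_derive_continuous (V := realify X)); eexists; apply Hf. }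
set (fb := BCFun X f Hc (ex_intro _ _ Hn)).
exists fb; split; [exact Hf|exact (norm_BC_le fb _ Hn)].
Qed.

(** Time reversal turns the derivation into its opposite, and so carries the half-plane Re l < 0 to
    Re l > 0, where the Laplace integral is available. *)
Definition bc_reflect g : BC X.
Proof.
refine (BCFun X (fun t => bc_fun g (- t)) _ _).
- intros t; apply (continuous_comp (fun t => - t) (bc_fun g)); [|apply bc_cont].
  exact (continuous_opp (V := R_NormedModule) (fun t => t) t (continuous_id t)).
- exists (norm g); intros t; apply norm_BC_ge.
Defined.

Lemma D_op_reflect f z : D_op X f z ->
  D_op X (bc_reflect f) ((- (1))%C ** bc_reflect z).
Proof.
intros H t.
assert (Hd : is_derive (fun s : R => - s) t (- 1)) by (auto_derive; [trivial|ring]).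
assert (K := is_derive_comp (V := realify X) (bc_fun f) (fun s => - s) t _ _ (H (- t)) Hd).
assert (Hz : RtoC (- 1) ** bc_fun z (- t) = (- (1))%C ** bc_fun z (- t))
  by (f_equal; unfold Copp, RtoC; simpl; f_equal; lra).
exact (eq_rect _ (fun v : X =>
  is_derive (V := realify X) (fun s => bc_fun f (- s)) t v) K _ Hz).
Qed.

Lemma resolvent_ex l g : Re l <> 0 ->
  exists f, D_op X f (minus (l ** f) g) /\ norm f <= norm g / Rabs (Re l).
Proof.
intros Hl; destruct (Rlt_or_le 0 (Re l)) as [Hp|Hn].
{ rewrite Rabs_pos_eq by lra; exact (resolvent_ex_pos l g Hp). }
assert (Hl' : 0 < Re (- l)) by (change (0 < - Re l); lra).
destruct (resolvent_ex_pos (- l)%C ((- (1))%C ** bc_reflect g) Hl') as [f [Hf Hfn]].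
exists (bc_reflect f); split.
- assert (K := D_op_reflect _ _ Hf).
  replace (minus (l ** bc_reflect f) g) with
    ((- (1))%C ** bc_reflect (minus ((- l)%C ** f) ((- (1))%C ** bc_reflect g)));
    [exact K|].
  apply bcfun_ext; intros t.
  change ((- (1))%C ** minus ((- l)%C ** bc_fun f (- t))
    ((- (1))%C ** bc_fun g (- - t)) = minus (l ** bc_fun f (- t)) (bc_fun g t)).
  rewrite Ropp_involutive; lin_ring.
- apply norm_BC_le; intros t; apply Rle_trans with (1 := norm_BC_ge f (- t)).
  apply Rle_trans with (1 := Hfn).
  rewrite Rabs_left1 by exact Hn; change (Re (- l)) with (- Re l).
  apply Rmult_le_compat_r; [apply Rlt_le, Rinv_0_lt_compat; lra|].
  apply norm_BC_le; intros s.
  change (norm ((- (1))%C ** bc_fun g (- s)) <= norm g).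
  rewrite norm_cscal, Cmod_opp, Cmod_1, Rmult_1_l; apply norm_BC_ge.
Qed.

(** The choice made by [epsilon] solves the same equation as [f], and bounded solutions are
    unique. *)
Lemma resolvent_D_op l f z : Re l <> 0 -> D_op X f z ->
  resolvent (D_op X) l (minus (l ** f) z) = f.
Proof.
intros Hl Hf; unfold resolvent.
destruct (epsilon_spec (inhabits zero)
  (fun x : BC X => exists w, D_op X x w /\ minus (l ** x) w = minus (l ** f) z)
  (ex_intro _ f (ex_intro _ z (conj Hf eq_refl)))) as [w [Hw Heq]].
exact (D_op_inj l _ _ _ _ Hl Hw Hf Heq).
Qed.

Lemma D_op_resolvent l g : Re l <> 0 ->
  D_op X (resolvent (D_op X) l g) (minus (l ** resolvent (D_op X) l g) g) /\
  norm (resolvent (D_op X) l g) <= norm g / Rabs (Re l).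
Proof.
intros Hl; destruct (resolvent_ex l g Hl) as [f [Hf Hn]].
assert (K := resolvent_D_op l _ _ Hl Hf).
replace (minus (l ** f) (minus (l ** f) g)) with g in K by lin_ring.
rewrite K; split; assumption.
Qed.

Lemma resolvent_plus l f g : Re l <> 0 -> resolvent (D_op X) l (plus f g) =
  plus (resolvent (D_op X) l f) (resolvent (D_op X) l g).
Proof.
intros Hl; destruct (D_op_resolvent l f Hl) as [Hf _].
destruct (D_op_resolvent l g Hl) as [Hg _].
set (u := resolvent _ _ f) in *; set (v := resolvent _ _ g) in *.
rewrite <- (resolvent_D_op l _ _ Hl (D_op_plus _ _ _ _ Hf Hg)).
f_equal; lin_ring.
Qed.

Lemma resolvent_scal l (k : C) f : Re l <> 0 -> resolvent (D_op X) l (k ** f) =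
  k ** resolvent (D_op X) l f.
Proof.
intros Hl; destruct (D_op_resolvent l f Hl) as [Hf _].
set (u := resolvent _ _ f) in *.
rewrite <- (resolvent_D_op l _ _ Hl (D_op_scal k _ _ Hf)).
f_equal; lin_ring.
Qed.

(** * The induced resolvent family on the quotient *)

Section Quotient.
Context (F : closed_subspace (BC X))
  (HF : forall l f, Re l <> 0 -> F f -> F (resolvent (D_op X) l f)).
Implicit Types (a b : Y_space X F).

(** Defined through a chosen representative; invariance of [F] under the resolvents makes the class
    independent of the choice off the axis. *)
Definition q_resolvent l a : Y_space X F := Rtilde X F l (repr (BC X) F a).

Lemma cls_repr a : cls F (repr (BC X) F a) = a.
Proof. exact (coset_ofK (BC X) F a). Qed.

Lemma cls_plus f g : cls F (plus f g) = plus (cls F f) (cls F g).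
Proof. exact (eq_sym (q_plusE (BC X) F f g)). Qed.

Lemma cls_scal (k : C) f : cls F (k ** f) = k ** cls F f.
Proof. exact (eq_sym (q_scalE (BC X) F k f)). Qed.

Lemma cls_minus f g : cls F (minus f g) = minus (cls F f) (cls F g).
Proof.
replace (minus f g) with (plus f ((- (1))%C ** g)) by lin_ring.
rewrite cls_plus, cls_scal; lin_ring.
Qed.

Lemma q_resolventE l f : Re l <> 0 -> q_resolvent l (cls F f) = Rtilde X F l f.
Proof.
intros Hl; apply (coset_of_eq (BC X) F).
set (r := repr (BC X) F (cls F f)).
replace (minus _ _) with (resolvent (D_op X) l (plus r ((- (1))%C ** f))).
- apply HF; [exact Hl|].
  replace (plus r ((- (1))%C ** f)) with (minus r f) by lin_ring.
  exact (repr_coset_of (BC X) F f).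
- rewrite resolvent_plus, resolvent_scal by exact Hl; lin_ring.
Qed.

Lemma q_resolvent_plus l a b : Re l <> 0 ->
  q_resolvent l (plus a b) = plus (q_resolvent l a) (q_resolvent l b).
Proof.
intros Hl; rewrite <- (cls_repr a), <- (cls_repr b), <- cls_plus.
rewrite !q_resolventE by exact Hl; unfold Rtilde.
rewrite resolvent_plus by exact Hl; apply cls_plus.
Qed.

Lemma q_resolvent_scal l (k : C) a : Re l <> 0 ->
  q_resolvent l (k ** a) = k ** q_resolvent l a.
Proof.
intros Hl; rewrite <- (cls_repr a), <- cls_scal.
rewrite !q_resolventE by exact Hl; unfold Rtilde.
rewrite resolvent_scal by exact Hl; apply cls_scal.
Qed.

(** The bound upstairs, applied to a representative whose norm exceeds that of the class by less
    than e |Re l|. *)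
Lemma q_resolvent_norm l a : Re l <> 0 ->
  norm (q_resolvent l a) <= norm a / Rabs (Re l).
Proof.
intros Hl; assert (Hr := Rabs_pos_lt _ Hl); apply le_epsilon; intros e He.
destruct (q_norm_approx (BC X) F a (e * Rabs (Re l))) as [f [Hf Hn]].
{ apply Rmult_lt_0_compat; assumption. }
change (cls F f = a) in Hf; rewrite <- Hf at 1; rewrite q_resolventE by exact Hl.
apply Rle_trans with (1 := q_norm_le (BC X) F _).
apply Rle_trans with (1 := proj2 (D_op_resolvent l f Hl)).
change (norm f < norm a + e * Rabs (Re l)) in Hn.
apply Rmult_le_reg_r with (Rabs (Re l)); [exact Hr|].
replace (norm f / Rabs (Re l) * Rabs (Re l)) with (norm f) by (field; lra).
replace ((norm a / Rabs (Re l) + e) * Rabs (Re l)) with (norm a + e * Rabs (Re l))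
  by (field; lra); lra.
Qed.

(** Conversely, R(l) y with y representing l a - b lies in the class [a], and its derivative l R(l)
    y - y in the class [b]. No uniqueness of [b] enters. *)
Lemma Dtilde_q_resolvent l a b : Re l <> 0 ->
  Dtilde X F a b <-> a = q_resolvent l (minus (l ** a) b).
Proof.
intros Hl; split.
- intros [f [z [Hf [-> ->]]]].
  rewrite <- cls_scal, <- cls_minus, q_resolventE by exact Hl; unfold Rtilde.
  rewrite resolvent_D_op; trivial.
- intros Ha; set (y := minus (l ** a) b) in Ha.
  destruct (D_op_resolvent l (repr (BC X) F y) Hl) as [Hf _].
  exists (resolvent (D_op X) l (repr (BC X) F y)).
  eexists; split; [exact Hf|split; [exact Ha|]].
  rewrite cls_minus, cls_scal, cls_repr.
  change (cls F (resolvent (D_op X) l (repr (BC X) F y))) with (q_resolvent l y).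
  rewrite <- Ha; unfold y; lin_ring.
Qed.

(** Contraposition, together with independence of the representative. An equality of predicates, so
    that it rewrites inside [resolvent_set] and [part]. *)
Lemma Lambda_spaceE (Lambda : R -> Prop) :
  Lambda_space F Lambda =
  (fun a => forall eta, ~ Lambda eta -> regular_at q_resolvent a eta).
Proof.
apply functional_extensionality; intros a; apply propositional_extensionality.
assert (Hreg : forall f eta, regular_at q_resolvent (cls F f) eta <->
  exists (U : C -> Prop) (G : C -> Y_space X F),
      open U /\ U (Ci * eta)%C /\ analytic_on U G /\
      forall lambda : C, U lambda -> Re lambda <> 0 -> G lambda = Rtilde X F lambda f).
{ intros f eta; split; intros [U [G [HU [HUe [HG HGe]]]]];
    exists U, G; repeat split; trivial; intros l Hl Hl0;
    rewrite HGe by assumption; [|symmetry]; apply q_resolventE; exact Hl0. }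
split.
- intros H eta He; rewrite <- (cls_repr a); apply Hreg.
  apply NNPP; intros K; apply He; apply (H _ (eq_sym (cls_repr a)) eta K).
- intros H f -> eta K; apply NNPP; intros He; apply K, Hreg, H, He.
Qed.

End Quotient.
End ResolventBC.

Theorem theorem2p12 (X : CompleteNormedModule C_AbsRing)
    (F : closed_subspace (BC X))
    (hF0 : nontrivial F) (hF : conditionF F)
    (Lambda : R -> Prop) (hLambda : closed Lambda) :
  forall lambda : C,
    spectrum (Lambda_space F Lambda) (Dtilde_part F Lambda) lambda ->
    exists xi : R, Lambda xi /\ lambda = (Ci * xi)%C.
Proof.
intros lambda Hspec; apply NNPP; intros Hno; apply Hspec.
set (cX := CompleteNormedModule.mixin C_AbsRing X (CompleteNormedModule.class C_AbsRing X)).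
assert (HF : forall l (f : BC X), Re l <> 0 -> F f -> F (resolvent (D_op X) l f)).
(* The zero subspace is excluded by [hF0]; the other case gives the invariance of [F] under the
   resolvents. *)
{ destruct hF as [H0|[_ [_ [H _]]]]; [|exact H].
  exfalso; destruct hF0 as [f [Hf Hne]]; apply Hne, H0, Hf. }
unfold Dtilde_part; rewrite (Lambda_spaceE X cX F HF).
apply resolvent_set_part; try assumption.
- intros l x y; apply (q_resolvent_plus X cX F HF).
- intros l k x; apply (q_resolvent_scal X cX F HF).
- intros l x; apply (q_resolvent_norm X cX F HF).
- intros l x z; apply (Dtilde_q_resolvent X cX F HF).
Qed.
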